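(* Let $a>0$, $c=a^2$, and let $\mathbf e_2\in\mathbb R^3$ be a unit vector. Then the function $$\mathbf u(x,t)=2a\,\frac{a\sinh(a(x-ct))\,(3ct-x)+\cosh(a(x-ct))}{\cosh^2(a(x-ct))+a^2(3ct-x)^2}\;\mathbf e_2,\qquad x,t\in\mathbb R,$$ is a solution of the vector modified Korteweg-de Vries equation $$\partial_t \mathbf u+6\,\mathbf u\times\partial_x^2\mathbf u+6\big(\mathbf u\,\partial_x|\mathbf u|^2-|\mathbf u|^2\,\partial_x\mathbf u\big)+\partial_x^3\mathbf u=0 .$$ For sufficiently large time it splits up into a sum of two oppositely directed solitons with amplitude $a$ (a soliton and an anti-soliton), the distance between which grows logarithmically with respect to time: $$\mathbf u(x,t)=\mathbf e_2\left(\frac{a}{\cosh(a(x-ct)-\ln(4a^3t))}-\frac{a}{\cosh(a(x-ct)+\ln(4a^3t))}\right),\qquad t\to\infty,$$ $$\mathbf u(x,t)=\mathbf e_2\left(-\frac{a}{\cosh(a(x-ct)-\ln(4a^3|t|))}+\frac{a}{\cosh(a(x-ct)+\ln(4a^3|t|))}\right),\qquad t\to-\infty.$$ As time increases, the soliton catches up with and then overtakes the anti-soliton; at their closest approach and interaction the resulting impulse is $$\mathbf u(x,0)=2a\,\frac{\cosh(ax)-ax\sinh(ax)}{\cosh^2(ax)+(ax)^2}\,\mathbf e_2 .$$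
   Context: Here $\mathbf u(x,t)\in\mathbb R^3$, $\times$ is the vector (cross) product in $\mathbb R^3$ and $|\cdot|$ is the Euclidean norm. The solution is called a doublet (soliton-antisoliton type); it is written in suitably shifted coordinates $x,t$. The two large-time formulas are asymptotic representations, given without an error term or a specified mode of convergence. *)

(* Defs.v *)
From Stdlib Require Import Reals.
From Coquelicot Require Import Coquelicot.

Open Scope R_scope.

(* R^3 carries Coquelicot's product normed-module structure, so that [plus],
   [minus], [opp], [scal] and [is_derive] apply to it directly. *)
Definition vec3 : Type := (R * R * R)%type.

Definition mkvec3 (x y z : R) : vec3 := (x, y, z).

Definition vx (v : vec3) : R := fst (fst v).
Definition vy (v : vec3) : R := snd (fst v).
Definition vz (v : vec3) : R := snd v.

Definition dot (v w : vec3) : R := vx v * vx w + vy v * vy w + vz v * vz w.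

Definition enorm (v : vec3) : R := sqrt (dot v v).

Definition cross (v w : vec3) : vec3 :=
  mkvec3 (vy v * vz w - vz v * vy w)
         (vz v * vx w - vx v * vz w)
         (vx v * vy w - vy v * vx w).

(* Classical solutions on the whole (x, t) plane of
     u_t + 6 u x u_xx + 6 (u (|u|^2)_x - |u|^2 u_x) + u_xxx = 0.
   Derivatives are unique, so the existential quantifiers only say that all the
   derivatives in the equation exist; [n_x] is that of |u|^2. *)
Definition is_vmKdV_solution (u : R -> R -> vec3) : Prop :=
  exists (u_t u_x u_xx u_xxx : R -> R -> vec3) (n_x : R -> R -> R),
    (forall x t, is_derive (fun s => u x s) t (u_t x t)) /\
    (forall x t, is_derive (fun y => u y t) x (u_x x t)) /\
    (forall x t, is_derive (fun y => u_x y t) x (u_xx x t)) /\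
    (forall x t, is_derive (fun y => u_xx y t) x (u_xxx x t)) /\
    (forall x t, is_derive (fun y => (enorm (u y t)) ^ 2) x (n_x x t)) /\
    (forall x t,
       plus (plus (plus (u_t x t)
                        (scal 6 (cross (u x t) (u_xx x t))))
                  (scal 6 (minus (scal (n_x x t) (u x t))
                                 (scal ((enorm (u x t)) ^ 2) (u_x x t)))))
            (u_xxx x t)
       = zero).

(* The one-soliton of amplitude a, speed a^2, direction e and phase delta; the
   anti-soliton is the one of direction [opp e]. *)
Definition soliton (a delta : R) (e : vec3) (x t : R) : vec3 :=
  scal (a / cosh (a * (x - a ^ 2 * t) - delta)) e.

Definition doublet (a c : R) (e2 : vec3) (x t : R) : vec3 :=
  scal (2 * a *
        ((a * sinh (a * (x - c * t)) * (3 * c * t - x) + cosh (a * (x - c * t)))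
         / ((cosh (a * (x - c * t))) ^ 2 + a ^ 2 * (3 * c * t - x) ^ 2))) e2.

(* [u] and [v] are asymptotically equal along the filter [F] of times,
   uniformly in x. *)
Definition asymptotic_to (F : (R -> Prop) -> Prop) (u v : R -> R -> vec3) : Prop :=
  forall eps : R, 0 < eps ->
    F (fun t => forall x, enorm (minus (u x t) (v x t)) < eps).

(* Positions at time t, meaningful also during the interaction: the soliton sits
   where the component of u along e is largest, the anti-soliton where it is
   smallest. *)
Definition soliton_at (u : R -> R -> vec3) (e : vec3) (t p : R) : Prop :=
  forall x, dot (u x t) e <= dot (u p t) e.

Definition antisoliton_at (u : R -> R -> vec3) (e : vec3) (t m : R) : Prop :=
  forall x, dot (u m t) e <= dot (u x t) e.

(* Main.v *)
(** In the variables xi = a (x - c t) and s = 2 a^3 t the doublet is 2 a f, where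
    f = (eta S + C) / (C^2 + eta^2), eta = s - xi, S = sinh xi, C = cosh xi. All
    values of u are multiples of e2, so the equation reduces to the scalar mKdV
    equation, a polynomial identity in eta, S, C modulo C^2 = 1 + S^2.

    The soliton and the anti-soliton sit at critical points of f in xi, and these
    form a rational curve: S = r (3 + r^2) / (1 - r^2), eta = 2 r / (1 + r^2) C. The
    branch |r| < 1 carries the maxima and |r| > 1 the minima, s is monotone in r on
    each branch, and f^2 = (1 + r^2) / (1 + 6 r^2 + r^4) decides which of the two
    minima is the global one. Monotonicity of the distance compares the two speeds
    d xi / d s with 1/2, and the logarithmic growth comes from
    s = xi + 2 r / (1 + r^2) cosh xi as r -> 1. *)

Require Import Defs.
From Stdlib Require Import Reals Lra Psatz.
From Coquelicot Require Import Coquelicot.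

Open Scope R_scope.

(** At every s the profile has two minima, one at xi < 0 with r > 1 and one at xi > 0 with r < -1.
    They are equally deep at s = 0, so the global minimum jumps there from the right side to the
    left: the position of the anti-soliton is not unique at that moment and not continuous in time,
    and only its distance from the maximum is unaffected. This is why the statements speak of
    arbitrary extrema p and m, and why everything is reduced to s >= 0 by the symmetry (s, xi) ->
    (-s, -xi). At s = 0 the maximum moves with d xi / d s = 3/5 and the minimum on the branch r > 1,
    at r near 4.32, follows with about 0.45. Both move the same way, so the growth of the distance
    cannot be read off from directions; 1/2 is a simple number between the two speeds. Neither
    inequality persists along its whole branch, and checking that each holds for long enough is what
    calls for numerical bounds. *)

Lemma cosh_sqr (x : R) : cosh x ^ 2 = 1 + sinh x ^ 2.
Proof.
  unfold cosh, sinh.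
  assert (H : exp x * exp (- x) = 1) by (rewrite <- exp_plus, Rplus_opp_r; apply exp_0).
  nra.
Qed.

Lemma cosh_opp (x : R) : cosh (- x) = cosh x.
Proof. unfold cosh; rewrite Ropp_involutive; lra. Qed.

Lemma sinh_opp (x : R) : sinh (- x) = - sinh x.
Proof. unfold sinh; rewrite Ropp_involutive; lra. Qed.

Lemma cosh_pos (x : R) : 0 < cosh x.
Proof. unfold cosh; generalize (exp_pos x) (exp_pos (- x)); lra. Qed.

Lemma cosh_ge_1 (x : R) : 1 <= cosh x.
Proof. generalize (cosh_sqr x) (cosh_pos x) (pow2_ge_0 (sinh x)); nra. Qed.

Lemma cosh_Rabs (x : R) : cosh (Rabs x) = cosh x.
Proof. unfold Rabs; destruct (Rcase_abs x); [apply cosh_opp | reflexivity]. Qed.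

Lemma cosh_eq_1 (x : R) : cosh x = 1 -> x = 0.
Proof.
  intros H.
  assert (S : sinh x = 0) by (apply Rsqr_0_uniq; unfold Rsqr; generalize (cosh_sqr x); rewrite H; lra).
  rewrite <- (arcsinh_sinh x), S; apply arcsinh_0.
Qed.

(** Squaring the tangent bound for exp at |x|/2 gives quadratic growth, which is what beats the
    factor s - xi, linear in xi, in the numerator of the profile. *)
Lemma cosh_lower (x : R) : (1 + Rabs x / 2) ^ 2 / 2 <= cosh x.
Proof.
  rewrite <- (cosh_Rabs x); unfold cosh.
  set (y := Rabs x).
  assert (Hy : 0 <= y) by apply Rabs_pos.
  assert (H : (1 + y / 2) ^ 2 <= exp y).
  { replace (exp y) with (exp (y / 2) ^ 2)
      by (simpl; rewrite Rmult_1_r, <- exp_plus; f_equal; lra).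
    apply pow_incr; split; [lra | apply exp_ineq1_le]. }
  generalize (exp_pos (- y)); lra.
Qed.

Lemma Rabs_le_cosh (x : R) : Rabs x <= cosh x.
Proof. generalize (cosh_lower x) (pow2_ge_0 (1 - Rabs x / 2)); lra. Qed.

Lemma cosh_arcsinh (y : R) : cosh (arcsinh y) = sqrt (1 + y ^ 2).
Proof.
  symmetry; apply sqrt_lem_1.
  - generalize (pow2_ge_0 y); lra.
  - generalize (cosh_pos (arcsinh y)); lra.
  - generalize (cosh_sqr (arcsinh y)); rewrite sinh_arcsinh; lra.
Qed.

Lemma arcsinh_opp (y : R) : arcsinh (- y) = - arcsinh y.
Proof.
  rewrite <- (sinh_arcsinh y) at 1.
  rewrite <- sinh_opp; apply arcsinh_sinh.
Qed.

Lemma sinh_pos (x : R) : 0 < x -> 0 < sinh x.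
Proof. intros H; rewrite <- sinh_0; apply sinh_lt, H. Qed.

(** * Solutions with a fixed direction *)

Lemma dot_scal_l (k : R) (v w : vec3) : dot (scal k v) w = k * dot v w.
Proof.
  destruct v as [[v1 v2] v3], w as [[w1 w2] w3].
  unfold dot, vx, vy, vz; simpl.
  unfold scal; simpl; unfold mult; simpl; ring.
Qed.

Lemma dot_comm (v w : vec3) : dot v w = dot w v.
Proof. unfold dot; ring. Qed.

Lemma dot_unit (e : vec3) : enorm e = 1 -> dot e e = 1.
Proof.
  unfold enorm; intros H.
  (* [sqrt] is 0 on negative arguments, so norm 1 also rules out a negative square. *)
  destruct (Rle_lt_dec 0 (dot e e)) as [P | N].
  - rewrite <- (sqrt_sqrt _ P), H; ring.
  - rewrite sqrt_neg_0 in H; lra.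
Qed.

Lemma enorm_scal_unit (k : R) (e : vec3) :
  enorm e = 1 -> enorm (scal k e) = Rabs k.
Proof.
  intros H; unfold enorm.
  rewrite dot_scal_l, dot_comm, dot_scal_l, (dot_unit _ H), Rmult_1_r.
  apply sqrt_Rsqr_abs.
Qed.

Lemma is_derive_scal_vec3 (f : R -> R) (x l : R) (e : vec3) :
  is_derive f x l -> is_derive (fun y => (scal (f y) e : vec3)) x (scal l e).
Proof.
  exact (@is_derive_scal_l R_AbsRing
           (prod_NormedModule _ (prod_NormedModule _ R_NormedModule R_NormedModule)
              R_NormedModule) f x l e).
Qed.

(* Since u and u_xx are parallel the cross product vanishes, and
   u (u^2)_x - u^2 u_x = u^2 u_x leaves the scalar mKdV equation. *)
Lemma scalar_mKdV_solution (g g_t g_x g_xx g_xxx : R -> R -> R) (e : vec3) :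
  enorm e = 1 ->
  (forall x t, is_derive (fun s => g x s) t (g_t x t)) ->
  (forall x t, is_derive (fun y => g y t) x (g_x x t)) ->
  (forall x t, is_derive (fun y => g_x y t) x (g_xx x t)) ->
  (forall x t, is_derive (fun y => g_xx y t) x (g_xxx x t)) ->
  (forall x t, g_t x t + 6 * g x t ^ 2 * g_x x t + g_xxx x t = 0) ->
  is_vmKdV_solution (fun x t => scal (g x t) e).
Proof.
  intros He Ht Hx Hxx Hxxx Heq.
  exists (fun x t => scal (g_t x t) e), (fun x t => scal (g_x x t) e),
    (fun x t => scal (g_xx x t) e), (fun x t => scal (g_xxx x t) e),
    (fun x t => 2 * g x t * g_x x t).
  refine (conj _ (conj _ (conj _ (conj _ (conj _ _))))); intros x t.
  - apply (is_derive_scal_vec3 (fun s => g x s)), Ht.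
  - apply (is_derive_scal_vec3 (fun y => g y t)), Hx.
  - apply (is_derive_scal_vec3 (fun y => g_x y t)), Hxx.
  - apply (is_derive_scal_vec3 (fun y => g_xx y t)), Hxxx.
  - apply (is_derive_ext (fun y => g y t ^ 2)).
    + intros y; rewrite (enorm_scal_unit _ _ He), pow2_abs; reflexivity.
    + replace (2 * g x t * g_x x t) with (INR 2 * g_x x t * g x t ^ 1)
        by (simpl; ring).
      apply (is_derive_pow (fun y => g y t)), Hx.
  - rewrite (enorm_scal_unit _ _ He), pow2_abs.
    specialize (Heq x t).
    destruct e as [[e1 e2] e3].
    unfold cross, mkvec3, vx, vy, vz; simpl.
    unfold minus, plus, opp, scal, zero; simpl;
      unfold prod_plus, prod_opp, prod_scal, prod_zero; simpl;
      unfold plus, opp, scal, zero; simpl;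
      unfold prod_plus, prod_opp, prod_scal, prod_zero; simpl;
      unfold plus, opp, scal, zero; simpl; unfold mult; simpl.
    simpl in Heq.
    apply (f_equal2 pair); [apply (f_equal2 pair) | ];
    (match goal with |- context [g_xxx x t * ?k] =>
      transitivity (k * (g_t x t + 6 * (g x t * (g x t * 1)) * g_x x t + g_xxx x t)) end;
      [ring | rewrite Heq; ring]).
Qed.

Lemma soliton_solution (a delta : R) (e : vec3) :
  0 < a -> enorm e = 1 -> is_vmKdV_solution (soliton a delta e).
Proof.
  intros Ha He.
  set (y := fun x t => a * (x - a ^ 2 * t) - delta).
  apply (scalar_mKdV_solution
    (fun x t => a / cosh (y x t))
    (fun x t => a ^ 4 * sinh (y x t) / cosh (y x t) ^ 2)
    (fun x t => - a ^ 2 * sinh (y x t) / cosh (y x t) ^ 2)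
    (fun x t => a ^ 3 * (cosh (y x t) ^ 2 - 2) / cosh (y x t) ^ 3)
    (fun x t => a ^ 4 * (6 - cosh (y x t) ^ 2) * sinh (y x t) / cosh (y x t) ^ 4));
    [exact He | intros x t; unfold y .. ];
    assert (HC := Rgt_not_eq _ _ (cosh_pos (a * (x - a ^ 2 * t) - delta)));
    assert (HS : sinh (a * (x - a ^ 2 * t) - delta) ^ 2
                 = cosh (a * (x - a ^ 2 * t) - delta) ^ 2 - 1)
      by (rewrite cosh_sqr; ring).
  1-4: auto_derive;
    [ repeat (apply Rgt_not_eq, cosh_pos || exact R1_neq_R0
              || apply Rmult_integral_contrapositive_currified) | ];
    unfold Rminus in *; simpl in *;
    set (C := cosh _) in *; set (S := sinh _) in *; clearbody C S;
    rewrite ?Rmult_1_r in *; field [HS]; auto.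
  set (C := cosh _) in *; set (S := sinh _) in *; clearbody C S.
  field; auto.
Qed.

(** * The doublet profile *)

Definition profile (s xi : R) : R :=
  ((s - xi) * sinh xi + cosh xi) / (cosh xi ^ 2 + (s - xi) ^ 2).

Lemma profile_denom_pos (s xi : R) : 0 < cosh xi ^ 2 + (s - xi) ^ 2.
Proof. generalize (cosh_pos xi) (pow2_ge_0 (s - xi)); nra. Qed.

Lemma profile_opp (s xi : R) : profile (- s) (- xi) = profile s xi.
Proof.
  unfold profile; rewrite cosh_opp, sinh_opp.
  f_equal; [ring | f_equal; ring].
Qed.

(* profile s = N / D with N = eta S + C, D = C^2 + eta^2, where eta = s - xi,
   S = sinh xi, C = cosh xi. The primes are derivatives in xi, so that eta' = -1,
   and the k-th derivative of the profile is Nk / D^(k+1). *)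
Section ProfileDerivatives.

Variables s xi : R.
Let eta := s - xi.
Let S := sinh xi.
Let C := cosh xi.
Let D := C ^ 2 + eta ^ 2.
Let D' := 2 * (C * S - eta).
Let D'' := 2 * (S ^ 2 + C ^ 2 + 1).
Let D''' := 8 * S * C.
Let N := eta * S + C.
Definition profile_num1 := eta * C * D - N * D'.
Let N1' := (eta * S - C) * D - N * D''.
Let N1'' := (eta * C - 2 * S) * D + (eta * S - C) * D' - eta * C * D'' - N * D'''.
Definition profile_num2 := N1' * D - 2 * profile_num1 * D'.
Let N2' := N1'' * D - N1' * D' - 2 * profile_num1 * D''.
Definition profile_num3 := N2' * D - 3 * profile_num2 * D'.

Definition profile_dx := profile_num1 / D ^ 2.
Definition profile_dxx := profile_num2 / D ^ 3.
Definition profile_dxxx := profile_num3 / D ^ 4.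
Definition profile_ds := (S * D - 2 * eta * N) / D ^ 2.

(** This is g_t + 6 g^2 g_x + g_xxx = 0 for g = 2 a f, divided by 2 a^4: the x-derivative acts as a
    d/dxi and the t-derivative as 2 a^3 d/ds - a^3 d/dxi. *)
Lemma profile_mKdV :
  - profile_dx + 2 * profile_ds + profile_dxxx
    + 24 * profile s xi ^ 2 * profile_dx = 0.
Proof.
  assert (HD : D <> 0) by apply Rgt_not_eq, profile_denom_pos.
  assert (HC : C ^ 2 = 1 + S ^ 2) by apply cosh_sqr.
  unfold profile_dx, profile_ds, profile_dxxx.
  replace (profile s xi) with (N / D) by reflexivity.
  replace (- (profile_num1 / D ^ 2) + 2 * ((S * D - 2 * eta * N) / D ^ 2)
           + profile_num3 / D ^ 4 + 24 * (N / D) ^ 2 * (profile_num1 / D ^ 2))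
    with ((- profile_num1 * D ^ 2 + 2 * (S * D - 2 * eta * N) * D ^ 2
           + profile_num3 + 24 * N ^ 2 * profile_num1) / D ^ 4) by (field; auto).
  unfold Rdiv; apply Rmult_eq_0_compat_r.
  unfold profile_num3, N2', profile_num2, profile_num1, N1'', N1', N, D''', D'', D', D.
  clearbody eta S C; clear - HC.
  ring [HC].
Qed.

End ProfileDerivatives.

(** One common power of the denominator is cancelled, which yields the recursion N(k+1) = Nk' D -
    (k+1) Nk D' and keeps the numerators small enough for [ring]. *)
Lemma is_derive_quotient_pow (n d : R -> R) (x n' d' : R) (k : nat) :
  d x <> 0 -> is_derive n x n' -> is_derive d x d' ->
  is_derive (fun y => n y / d y ^ S k) x
    ((n' * d x - INR (S k) * n x * d') / d x ^ S (S k)).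
Proof.
  intros Hd Hn Hd'.
  replace ((n' * d x - INR (S k) * n x * d') / d x ^ S (S k))
    with ((n' * d x ^ S k - n x * (INR (S k) * d' * d x ^ k)) / (d x ^ S k) ^ 2).
  - apply is_derive_div; [exact Hn | | now apply pow_nonzero].
    apply (is_derive_pow d (S k) x d' Hd').
  - simpl; field; split; [apply pow_nonzero |]; assumption.
Qed.

Lemma is_derive_profile_denom (s xi : R) :
  is_derive (fun y => cosh y ^ 2 + (s - y) ^ 2) xi (2 * (cosh xi * sinh xi - (s - xi))).
Proof. auto_derive; [trivial | ring]. Qed.

Lemma is_derive_profile (s xi : R) : is_derive (profile s) xi (profile_dx s xi).
Proof.
  apply (is_derive_ext
    (fun y => ((s - y) * sinh y + cosh y) / (cosh y ^ 2 + (s - y) ^ 2) ^ 1)).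
  { intros y; unfold profile; f_equal; ring. }
  evar_last.
  - apply (is_derive_quotient_pow _ (fun y => cosh y ^ 2 + (s - y) ^ 2)).
    + apply Rgt_not_eq, profile_denom_pos.
    + auto_derive; [trivial | reflexivity].
    + apply is_derive_profile_denom.
  - unfold profile_dx, profile_num1; f_equal; simpl; ring.
Qed.

Lemma is_derive_profile_dx (s xi : R) :
  is_derive (profile_dx s) xi (profile_dxx s xi).
Proof.
  evar_last.
  - apply (is_derive_quotient_pow _ (fun y => cosh y ^ 2 + (s - y) ^ 2)).
    + apply Rgt_not_eq, profile_denom_pos.
    + unfold profile_num1; auto_derive; [trivial | reflexivity].
    + apply is_derive_profile_denom.
  - unfold profile_dxx, profile_num2, profile_num1; f_equal; simpl; ring.
Qed.

Lemma is_derive_profile_dxx (s xi : R) :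
  is_derive (profile_dxx s) xi (profile_dxxx s xi).
Proof.
  evar_last.
  - apply (is_derive_quotient_pow _ (fun y => cosh y ^ 2 + (s - y) ^ 2)).
    + apply Rgt_not_eq, profile_denom_pos.
    + unfold profile_num2, profile_num1; auto_derive; [trivial | reflexivity].
    + apply is_derive_profile_denom.
  - unfold profile_dxxx, profile_num3, profile_num2, profile_num1; f_equal; simpl; ring.
Qed.

(** Time moves both arguments of the profile at once; differentiating along a straight line replaces
    a chain rule in two variables. *)
Lemma is_derive_profile_moving (s v xi w t : R) :
  is_derive (fun t => profile (s + v * t) (xi - w * t)) t
    (v * profile_ds (s + v * t) (xi - w * t) - w * profile_dx (s + v * t) (xi - w * t)).
Proof.
  assert (HD := Rgt_not_eq _ _ (profile_denom_pos (s + v * t) (xi - w * t))).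
  apply (is_derive_ext
    (fun t => ((s + v * t - (xi - w * t)) * sinh (xi - w * t) + cosh (xi - w * t))
              / (cosh (xi - w * t) ^ 2 + (s + v * t - (xi - w * t)) ^ 2) ^ 1)).
  { intros y; unfold profile; f_equal; ring. }
  evar_last.
  - apply (is_derive_quotient_pow _
      (fun t => cosh (xi - w * t) ^ 2 + (s + v * t - (xi - w * t)) ^ 2)).
    + exact HD.
    + auto_derive; [trivial | reflexivity].
    + auto_derive; [trivial | reflexivity].
  - unfold profile_ds, profile_dx, profile_num1; simpl; unfold Rminus in *; simpl in HD.
    rewrite !Rmult_1_r in *; field; exact HD.
Qed.

Lemma doublet_profile (a : R) (e : vec3) (x t : R) :
  0 < a ->
  doublet a (a ^ 2) e x t
    = scal (2 * a * profile (2 * a ^ 3 * t) (a * (x - a ^ 2 * t))) e.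
Proof.
  intros Ha; unfold doublet, profile; do 2 f_equal; f_equal; [ring | f_equal; ring].
Qed.

Lemma doublet_solution (a : R) (e : vec3) :
  0 < a -> enorm e = 1 -> is_vmKdV_solution (doublet a (a ^ 2) e).
Proof.
  intros Ha He.
  set (xi := fun x t => a * (x - a ^ 2 * t)).
  set (s := fun t => 2 * a ^ 3 * t).
  assert (Hxi : forall x t, is_derive (fun y => xi y t) x a).
  { intros x t; unfold xi; auto_derive; [trivial | ring]. }
  assert (Hc : forall (f f' : R -> R) k x t,
    (forall y, is_derive f y (f' y)) ->
    is_derive (fun y => k * f (xi y t)) x (k * a * f' (xi x t))).
  { intros f f' k x t Hf.
    replace (k * a * f' (xi x t)) with (k * (a * f' (xi x t))) by ring.
    apply is_derive_scal.
    apply (is_derive_comp f (fun y => xi y t)); [apply Hf | apply Hxi]. }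
  assert (H : is_vmKdV_solution
    (fun x t => scal (2 * a * profile (s t) (xi x t)) e)).
  { apply (scalar_mKdV_solution
      (fun x t => 2 * a * profile (s t) (xi x t))
      (fun x t => 2 * a * (2 * a ^ 3 * profile_ds (s t) (xi x t)
                           - a ^ 3 * profile_dx (s t) (xi x t)))
      (fun x t => 2 * a * a * profile_dx (s t) (xi x t))
      (fun x t => 2 * a * a * a * profile_dxx (s t) (xi x t))
      (fun x t => 2 * a * a * a * a * profile_dxxx (s t) (xi x t)));
      [exact He | intros x t .. ].
    - apply is_derive_scal.
      apply (is_derive_ext (fun t => profile (0 + 2 * a ^ 3 * t) (a * x - a ^ 3 * t))).
      { intros y; f_equal; unfold s, xi; ring. }
      evar_last; [apply is_derive_profile_moving |].
      replace (0 + 2 * a ^ 3 * t) with (s t) by (unfold s; ring).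
      replace (a * x - a ^ 3 * t) with (xi x t) by (unfold xi; ring).
      reflexivity.
    - apply Hc, is_derive_profile.
    - apply Hc, is_derive_profile_dx.
    - apply Hc, is_derive_profile_dxx.
    - generalize (profile_mKdV (s t) (xi x t)); intros E.
      transitivity (2 * a ^ 4 * (- profile_dx (s t) (xi x t)
        + 2 * profile_ds (s t) (xi x t) + profile_dxxx (s t) (xi x t)
        + 24 * profile (s t) (xi x t) ^ 2 * profile_dx (s t) (xi x t)));
        [ring | rewrite E; ring]. }
  assert (E : doublet a (a ^ 2) e
              = (fun x t => scal (2 * a * profile (s t) (xi x t)) e)).
  { do 2 (apply FunctionalExtensionality.functional_extensionality; intro).
    apply doublet_profile, Ha. }
  rewrite E; exact H.
Qed.

(** * Critical points of the profile *)

(* The critical points of [profile s] form a rational curve. With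
   w = eta / C the condition reads (w S + 1)^2 = (1 + w^2)^2 / (1 - w^2); putting
   w = 2 r / (1 + r^2) and q = (1 - r^2) / (1 + r^2), a signed square root of
   1 - w^2, it becomes S = r (3 + r^2) / (1 - r^2). The value of the profile is
   then 1 / (C q): maxima have |r| < 1 and minima |r| > 1. *)
Definition crit_sinh (r : R) : R := r * (3 + r ^ 2) / (1 - r ^ 2).
Definition crit_ratio (r : R) : R := 2 * r / (1 + r ^ 2).
Definition crit_pos (r : R) : R := arcsinh (crit_sinh r).
Definition crit_time (r : R) : R := crit_pos r + crit_ratio r * cosh (crit_pos r).

Lemma sinh_crit_pos (r : R) : sinh (crit_pos r) = crit_sinh r.
Proof. apply sinh_arcsinh. Qed.

Lemma cosh_crit_pos_sqr (r : R) : r ^ 2 <> 1 ->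
  cosh (crit_pos r) ^ 2 = (1 + 6 * r ^ 2 + r ^ 4) * (1 + r ^ 2) / (1 - r ^ 2) ^ 2.
Proof.
  intros Hr; rewrite cosh_sqr, sinh_crit_pos; unfold crit_sinh; field.
  intros E; apply Hr; lra.
Qed.

Lemma profile_critical (s xi : R) :
  profile_dx s xi = 0 -> exists r, r ^ 2 <> 1 /\ xi = crit_pos r /\ s = crit_time r.
Proof.
  intros H.
  assert (HD := profile_denom_pos s xi).
  assert (HN : profile_num1 s xi = 0).
  { unfold profile_dx in H.
    apply (Rmult_eq_reg_r (/ (cosh xi ^ 2 + (s - xi) ^ 2) ^ 2)).
    - rewrite Rmult_0_l; exact H.
    - apply Rinv_neq_0_compat, pow_nonzero; lra. }
  unfold profile_num1 in HN.
  assert (HC := cosh_pos xi).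
  assert (HS := cosh_sqr xi).
  set (C := cosh xi) in *; set (S := sinh xi) in *.
  set (w := (s - xi) / C).
  assert (Hs : s - xi = w * C) by (unfold w; field; lra).
  rewrite Hs in HN.
  assert (E : (w ^ 2 - 1) * (C ^ 2 * w + 2 * S) + 4 * w = 0).
  { apply (Rmult_eq_reg_l (C ^ 2)); [| apply pow_nonzero; lra].
    rewrite Rmult_0_r, <- HN.
    ring [HS]. }
  (* Multiplied by w, the equation completes to a square in w S + 1. *)
  assert (Hk : (1 - w ^ 2) * (w * S + 1) ^ 2 = (1 + w ^ 2) ^ 2).
  { rewrite HS in E.
    transitivity ((1 + w ^ 2) ^ 2 - w * ((w ^ 2 - 1) * ((1 + S ^ 2) * w + 2 * S) + 4 * w));
      [ring | rewrite E; ring]. }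
  set (k := w * S + 1) in *.
  assert (Hw := pow2_ge_0 w).
  assert (k0 : k <> 0).
  { intros K; rewrite K in Hk; nra. }
  (* The square root of 1 - w^2 that has the sign of [k]. If w = sin theta and q = cos theta, then
     the [r] below is tan (theta / 2), and the sign of q decides between |r| < 1 and |r| > 1. *)
  set (q := (1 + w ^ 2) / k).
  assert (Hq : q ^ 2 = 1 - w ^ 2).
  { unfold q, Rdiv; rewrite Rpow_mult_distr, <- Hk; field; exact k0. }
  assert (Hqk : q * k = 1 + w ^ 2) by (unfold q; field; exact k0).
  assert (q0 : q <> 0) by (intros K; rewrite K in Hqk; nra).
  (* q = -1 would be the point r = infinity; it forces w = 0 and k = 1, against [Hqk]. *)
  assert (q1 : 1 + q <> 0).
  { intros K; assert (Q : q = - 1) by lra.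
    assert (W : w = 0) by (apply Rsqr_0_uniq; unfold Rsqr; rewrite Q in Hq; nra).
    unfold k in Hqk; rewrite Q, W in Hqk; lra. }
  set (r := w / (1 + q)).
  assert (Hr : r ^ 2 = (1 - q) / (1 + q)).
  { unfold r, Rdiv; rewrite Rpow_mult_distr.
    replace (w ^ 2) with ((1 - q) * (1 + q)) by (generalize Hq; lra).
    field; exact q1. }
  assert (Hr1 : 1 + r ^ 2 = 2 / (1 + q)) by (rewrite Hr; field; exact q1).
  assert (Hr2 : 1 - r ^ 2 = 2 * q / (1 + q)) by (rewrite Hr; field; exact q1).
  assert (Hratio : crit_ratio r = w).
  { unfold crit_ratio; rewrite Hr1; unfold r; field; exact q1. }
  assert (HSr : crit_sinh r = S).
  { unfold crit_sinh; rewrite Hr2.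
    replace (3 + r ^ 2) with (2 + 2 / (1 + q)) by lra.
    unfold r.
    replace (w / (1 + q) * (2 + 2 / (1 + q)) / (2 * q / (1 + q)))
      with (w * (2 + q) / (q * (1 + q))) by (field; auto).
    (* S enters only through w S = k - 1, hence the multiplication by w; for w = 0 the equation [E]
       itself gives S = 0. *)
    destruct (Req_dec w 0) as [W | W].
    - rewrite W in E |- *; unfold Rdiv; lra.
    - apply (Rmult_eq_reg_l w); [| exact W].
      apply (Rmult_eq_reg_l (q * (1 + q))); [| now apply Rmult_integral_contrapositive_currified].
      transitivity (w ^ 2 * (2 + q)); [field; auto |].
      transitivity ((1 + q) * (q * k - q)); [| unfold k; ring].
      rewrite Hqk; generalize Hq; intros; nra. }
  exists r; split; [| split].
  - intros K; rewrite K in Hr2.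
    apply (Rmult_integral_contrapositive_currified q (/ (1 + q)) q0
             (Rinv_neq_0_compat _ q1)).
    unfold Rdiv in Hr2; lra.
  - unfold crit_pos; rewrite HSr; symmetry; apply arcsinh_sinh.
  - unfold crit_time, crit_pos; rewrite HSr, Hratio.
    unfold S; rewrite arcsinh_sinh; fold C; lra.
Qed.

Lemma cosh_crit_pos (r : R) : r ^ 2 <> 1 ->
  (1 - r ^ 2) ^ 2 * cosh (crit_pos r) ^ 2 = (1 + 6 * r ^ 2 + r ^ 4) * (1 + r ^ 2).
Proof.
  intros Hr; rewrite (cosh_crit_pos_sqr _ Hr); field.
  intros E; apply Hr; lra.
Qed.

Lemma profile_crit (r : R) : r ^ 2 <> 1 ->
  profile (crit_time r) (crit_pos r) * (cosh (crit_pos r) * (1 - r ^ 2)) = 1 + r ^ 2.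
Proof.
  intros Hr.
  assert (HC := cosh_pos (crit_pos r)).
  assert (Hr1 : 1 - r ^ 2 <> 0) by (intros E; apply Hr; lra).
  assert (Hr2 := pow2_ge_0 r).
  unfold profile, crit_time.
  rewrite sinh_crit_pos; unfold crit_sinh.
  replace (crit_pos r + crit_ratio r * cosh (crit_pos r) - crit_pos r)
    with (crit_ratio r * cosh (crit_pos r)) by ring.
  set (C := cosh (crit_pos r)) in *; clearbody C.
  unfold crit_ratio.
  field; repeat split; try lra.
  replace (_ + _) with (C ^ 2 * ((1 + r ^ 2) ^ 2 + (2 * r) ^ 2)) by ring.
  apply Rgt_not_eq, Rmult_lt_0_compat; nra.
Qed.

Lemma profile_crit_pos (r : R) : r ^ 2 < 1 -> 0 < profile (crit_time r) (crit_pos r).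
Proof.
  intros Hr.
  assert (E := profile_crit r (Rlt_not_eq _ _ Hr)).
  assert (HC := cosh_pos (crit_pos r)).
  assert (P : 0 < cosh (crit_pos r) * (1 - r ^ 2)) by (apply Rmult_lt_0_compat; lra).
  generalize (pow2_ge_0 r); nra.
Qed.

Lemma profile_crit_neg (r : R) : 1 < r ^ 2 -> profile (crit_time r) (crit_pos r) < 0.
Proof.
  intros Hr.
  assert (E := profile_crit r (Rgt_not_eq _ _ Hr)).
  assert (HC := cosh_pos (crit_pos r)).
  assert (P : 0 < cosh (crit_pos r) * (r ^ 2 - 1)) by (apply Rmult_lt_0_compat; lra).
  generalize (pow2_ge_0 r); nra.
Qed.

Lemma profile_crit_sqr (r : R) : r ^ 2 <> 1 ->
  profile (crit_time r) (crit_pos r) ^ 2 * (1 + 6 * r ^ 2 + r ^ 4) = 1 + r ^ 2.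
Proof.
  intros Hr.
  assert (E := profile_crit r Hr).
  assert (E2 := cosh_crit_pos r Hr).
  assert (Hr2 := pow2_ge_0 r).
  apply (Rmult_eq_reg_r (1 + r ^ 2)); [| lra].
  rewrite Rmult_assoc, <- E2.
  set (f := profile _ _) in *; set (C := cosh _) in *.
  transitivity ((f * (C * (1 - r ^ 2))) ^ 2); [ring | rewrite E; ring].
Qed.

(** Minima with r closer to 1 are deeper. After reflecting the minimum with r < -1 to r > 1, this
    comparison identifies the global one. *)
Lemma profile_crit_sqr_decr (r1 r2 : R) :
  1 < r1 -> r1 < r2 ->
  profile (crit_time r2) (crit_pos r2) ^ 2 < profile (crit_time r1) (crit_pos r1) ^ 2.
Proof.
  intros H1 H2.
  assert (Z1 : 1 < r1 ^ 2) by nra.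
  assert (Z2 : r1 ^ 2 < r2 ^ 2) by nra.
  assert (E1 := profile_crit_sqr r1 (Rgt_not_eq _ _ Z1)).
  assert (E2 := profile_crit_sqr r2 (Rgt_not_eq _ _ (Rlt_trans _ _ _ Z1 Z2))).
  set (f1 := _ ^ 2) in E1 at 1; fold f1.
  set (f2 := _ ^ 2) in E2 at 1; fold f2.
  replace (r1 ^ 4) with (r1 ^ 2 * r1 ^ 2) in E1 by ring.
  replace (r2 ^ 4) with (r2 ^ 2 * r2 ^ 2) in E2 by ring.
  set (z1 := r1 ^ 2) in *; set (z2 := r2 ^ 2) in *; clearbody f1 f2 z1 z2.
  assert (P1 : 0 < 1 + 6 * z1 + z1 * z1) by nra.
  assert (P2 : 0 < 1 + 6 * z2 + z2 * z2) by nra.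
  apply (Rmult_lt_reg_r ((1 + 6 * z1 + z1 * z1) * (1 + 6 * z2 + z2 * z2)));
    [now apply Rmult_lt_0_compat |].
  replace (f2 * _) with ((1 + z2) * (1 + 6 * z1 + z1 * z1)) by (rewrite <- E2; ring).
  replace (f1 * _) with ((1 + z1) * (1 + 6 * z2 + z2 * z2)) by (rewrite <- E1; ring).
  assert (0 < (z2 - z1) * (5 + z1 + z2 + z1 * z2)) by (apply Rmult_lt_0_compat; nra).
  lra.
Qed.

Lemma crit_pos_opp (r : R) : crit_pos (- r) = - crit_pos r.
Proof.
  unfold crit_pos; rewrite <- arcsinh_opp; f_equal.
  unfold crit_sinh; replace ((- r) ^ 2) with (r ^ 2) by ring.
  unfold Rdiv; ring.
Qed.

Lemma crit_time_opp (r : R) : crit_time (- r) = - crit_time r.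
Proof.
  unfold crit_time; rewrite crit_pos_opp, cosh_opp.
  unfold crit_ratio; replace ((- r) ^ 2) with (r ^ 2) by ring.
  unfold Rdiv; ring.
Qed.

(** * Monotonicity along the critical curve *)

Definition crit_pos_d (r : R) : R :=
  (3 + 6 * r ^ 2 - r ^ 4) / (1 - r ^ 2) ^ 2 / cosh (crit_pos r).

Definition crit_time_d (r : R) : R :=
  (1 + 6 * r ^ 2 + r ^ 4) * (5 + 2 * r ^ 2 + r ^ 4)
  / ((1 - r ^ 2) ^ 3 * (1 + r ^ 2)) / cosh (crit_pos r).

Lemma is_derive_crit_pos (r : R) : r ^ 2 <> 1 ->
  is_derive crit_pos r (crit_pos_d r).
Proof.
  intros Hr.
  assert (Hr1 : 1 - r ^ 2 <> 0) by (intros E; apply Hr; lra).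
  evar_last.
  - apply (is_derive_comp arcsinh crit_sinh).
    + apply is_derive_Reals, derivable_pt_lim_arcsinh.
    + unfold crit_sinh; auto_derive; [| reflexivity].
      intros E; apply Hr1; rewrite <- E; ring.
  - unfold scal; simpl; unfold mult; simpl.
    unfold crit_pos_d, crit_pos; rewrite cosh_arcsinh.
    replace (1 + crit_sinh r ^ 2) with (crit_sinh r ^ 2 + 1) by ring.
    simpl.
    set (k := sqrt _).
    assert (K : k <> 0).
    { apply Rgt_not_eq, sqrt_lt_R0; nra. }
    clearbody k; simpl in *; rewrite !Rmult_1_r in *; field; auto.
Qed.

(** The terms combine to a multiple of 1 / C, where the remaining C^2 is rational in r by
    [cosh_crit_pos_sqr]; the resulting factorisation shows the sign to be that of 1 - r^2. *)
Lemma is_derive_crit_time (r : R) : r ^ 2 <> 1 ->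
  is_derive crit_time r (crit_time_d r).
Proof.
  intros Hr.
  assert (Hr1 : 1 - r ^ 2 <> 0) by (intros E; apply Hr; lra).
  assert (Hr2 : 1 + r ^ 2 <> 0) by (generalize (pow2_ge_0 r); lra).
  assert (HC := Rgt_not_eq _ _ (cosh_pos (crit_pos r))).
  assert (E2 := cosh_crit_pos_sqr r Hr).
  evar_last.
  - unfold crit_time, crit_ratio.
    apply (is_derive_plus crit_pos (fun r => 2 * r / (1 + r ^ 2) * cosh (crit_pos r))).
    + apply is_derive_crit_pos, Hr.
    + apply (is_derive_mult (fun r => 2 * r / (1 + r ^ 2)) (fun r => cosh (crit_pos r))).
      * auto_derive; [intros E; apply Hr2; rewrite <- E; ring | reflexivity].
      * apply (is_derive_comp cosh crit_pos).
        -- apply is_derive_Reals, derivable_pt_lim_cosh.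
        -- apply is_derive_crit_pos, Hr.
      * intros; apply Rmult_comm.
  - unfold plus, mult, scal; simpl; unfold mult; simpl.
    rewrite sinh_crit_pos; unfold crit_sinh, crit_pos_d, crit_time_d.
    set (C := cosh _) in *; clearbody C.
    transitivity (((3 + 6 * r ^ 2 - r ^ 4) / (1 - r ^ 2) ^ 2
                   * (1 + 2 * r / (1 + r ^ 2) * (r * (3 + r ^ 2) / (1 - r ^ 2)))
                   + 2 * (1 - r ^ 2) / (1 + r ^ 2) ^ 2 * C ^ 2) / C).
    + field; simpl in *; repeat split; assumption.
    + rewrite E2; field; repeat split; assumption.
Qed.

Lemma derive_pos_lt (f df : R -> R) (a b : R) :
  a < b ->
  (forall x, a <= x <= b -> is_derive f x (df x)) ->
  (forall x, a < x < b -> 0 < df x) -> f a < f b.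
Proof.
  intros Hab Hf Hdf.
  destruct (MVT_cor2 f df a b Hab) as (x & E & Hx).
  { intros x Hx; apply is_derive_Reals, Hf, Hx. }
  specialize (Hdf x Hx); nra.
Qed.

Lemma crit_time_d_sign (r : R) : r ^ 2 <> 1 -> 0 < crit_time_d r * (1 - r ^ 2).
Proof.
  intros Hr.
  assert (Hr1 : 1 - r ^ 2 <> 0) by (intros E; apply Hr; lra).
  assert (Hr2 := pow2_ge_0 r).
  assert (HC := cosh_pos (crit_pos r)).
  replace (crit_time_d r * (1 - r ^ 2)) with
    ((1 + 6 * r ^ 2 + r ^ 2 * r ^ 2) * (5 + 2 * r ^ 2 + r ^ 2 * r ^ 2)
     / ((1 - r ^ 2) ^ 2 * (1 + r ^ 2) * cosh (crit_pos r)))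
    by (unfold crit_time_d; field; repeat split; lra).
  apply Rdiv_lt_0_compat.
  - apply Rmult_lt_0_compat; nra.
  - apply Rmult_lt_0_compat; [apply Rmult_lt_0_compat |]; try lra.
    now apply pow2_gt_0.
Qed.

Lemma crit_time_incr (r1 r2 : R) :
  -1 < r1 -> r1 < r2 -> r2 < 1 -> crit_time r1 < crit_time r2.
Proof.
  intros H1 H12 H2; apply (derive_pos_lt _ crit_time_d _ _ H12).
  - intros x Hx; apply is_derive_crit_time; nra.
  - intros x Hx; assert (Z : x ^ 2 < 1) by nra.
    generalize (crit_time_d_sign x (Rlt_not_eq _ _ Z)); nra.
Qed.

Lemma crit_time_decr (r1 r2 : R) :
  1 < r1 -> r1 < r2 -> crit_time r2 < crit_time r1.
Proof.
  intros H1 H12; apply Ropp_lt_cancel.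
  apply (derive_pos_lt (fun r => - crit_time r) (fun r => - crit_time_d r) _ _ H12).
  - intros x Hx; apply (is_derive_opp crit_time), is_derive_crit_time; nra.
  - intros x Hx; assert (Z : 1 < x ^ 2) by nra.
    generalize (crit_time_d_sign x (Rgt_not_eq _ _ Z)); nra.
Qed.

Lemma crit_time_0 : crit_time 0 = 0.
Proof.
  generalize (crit_time_opp 0); rewrite Ropp_0; lra.
Qed.

Lemma crit_pos_incr (r1 r2 : R) :
  -1 < r1 -> r1 < r2 -> r2 < 1 -> crit_pos r1 < crit_pos r2.
Proof.
  intros H1 H12 H2; apply (derive_pos_lt _ crit_pos_d _ _ H12).
  - intros x Hx; apply is_derive_crit_pos; nra.
  - intros x Hx; assert (Z : x ^ 2 < 1) by nra.
    unfold crit_pos_d; apply Rdiv_lt_0_compat; [| apply cosh_pos].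
    apply Rdiv_lt_0_compat.
    + replace (x ^ 4) with (x ^ 2 * x ^ 2) by ring; nra.
    + apply pow2_gt_0; lra.
Qed.

Lemma crit_pos_neg (r : R) : 1 < r -> crit_pos r < 0.
Proof.
  intros Hr; unfold crit_pos; rewrite <- arcsinh_0; apply arcsinh_lt.
  unfold crit_sinh, Rdiv.
  assert (Z : / (1 - r ^ 2) < 0) by (apply Rinv_lt_0_compat; nra).
  assert (0 < r * (3 + r ^ 2)) by nra.
  nra.
Qed.

Lemma crit_pos_0 : crit_pos 0 = 0.
Proof. generalize (crit_pos_opp 0); rewrite Ropp_0; lra. Qed.

(* 5/2 lies just below the zero sqrt (3 + 2 sqrt 3) of crit_pos_d. *)
Lemma crit_pos_incr_near_1 (r1 r2 : R) :
  1 < r1 -> r1 < r2 -> r2 <= 5 / 2 -> crit_pos r1 < crit_pos r2.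
Proof.
  intros H1 H12 H2; apply (derive_pos_lt _ crit_pos_d _ _ H12).
  - intros x Hx; apply is_derive_crit_pos; nra.
  - intros x Hx.
    assert (Z : 1 < x ^ 2) by nra.
    assert (Z' : x ^ 2 < 25 / 4) by nra.
    unfold crit_pos_d; apply Rdiv_lt_0_compat; [| apply cosh_pos].
    apply Rdiv_lt_0_compat.
    + replace (x ^ 4) with (x ^ 2 * x ^ 2) by ring; nra.
    + apply pow2_gt_0; lra.
Qed.

(* For |r| < 1 it increases where d xi / d s > 1/2; for r > 1, where s decreases in
   r, it increases where d xi / d s < 1/2. *)
Definition crit_drift (r : R) : R := crit_pos r - crit_time r / 2.

Definition crit_drift_d (r : R) : R :=
  (r ^ 8 / 2 - 10 * r ^ 6 - 13 * r ^ 4 - 10 * r ^ 2 + 1 / 2)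
  / ((1 - r ^ 2) ^ 3 * (1 + r ^ 2)) / cosh (crit_pos r).

Lemma is_derive_crit_drift (r : R) : r ^ 2 <> 1 ->
  is_derive crit_drift r (crit_drift_d r).
Proof.
  intros Hr.
  assert (Hr1 : 1 - r ^ 2 <> 0) by (intros E; apply Hr; lra).
  assert (Hr2 : 1 + r ^ 2 <> 0) by (generalize (pow2_ge_0 r); lra).
  assert (HC := Rgt_not_eq _ _ (cosh_pos (crit_pos r))).
  apply (is_derive_ext (fun r => minus (crit_pos r) (scal (/ 2) (crit_time r)))).
  { intros t; unfold crit_drift, minus, plus, opp, scal; simpl; unfold mult; simpl; lra. }
  evar_last.
  - apply (is_derive_minus crit_pos (fun r => scal (/ 2) (crit_time r))).
    + apply is_derive_crit_pos, Hr.
    + apply is_derive_scal, is_derive_crit_time, Hr.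
  - unfold minus, plus, opp, crit_pos_d, crit_time_d, crit_drift_d; simpl.
    simpl in *; rewrite !Rmult_1_r in *; field; auto.
Qed.

(** 1/5 lies just below the zero of [crit_drift_d] near 0.217. *)
Lemma crit_drift_incr_small (r1 r2 : R) :
  0 <= r1 -> r1 < r2 -> r2 <= 1 / 5 -> crit_drift r1 < crit_drift r2.
Proof.
  intros H1 H12 H2; apply (derive_pos_lt _ crit_drift_d _ _ H12).
  - intros x Hx; apply is_derive_crit_drift; nra.
  - intros x Hx.
    assert (Z : 0 <= x ^ 2) by nra.
    assert (Z' : x ^ 2 <= 1 / 25) by nra.
    unfold crit_drift_d; apply Rdiv_lt_0_compat; [| apply cosh_pos].
    replace (x ^ 8) with (x ^ 2 * x ^ 2 * (x ^ 2 * x ^ 2)) by ring.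
    replace (x ^ 6) with (x ^ 2 * x ^ 2 * x ^ 2) by ring.
    replace (x ^ 4) with (x ^ 2 * x ^ 2) by ring.
    set (z := x ^ 2) in *; clearbody z.
    assert (z * z <= z / 25) by nra.
    assert (z * z * z <= z / 625) by nra.
    apply Rdiv_lt_0_compat; [nra |].
    apply Rmult_lt_0_compat; [apply pow_lt |]; lra.
Qed.

(** 9/2 lies between the zero of [crit_time] near 4.32, which is the minimum at s = 0, and the zero
    of [crit_drift_d] near 4.61. *)
Lemma crit_drift_incr_large (r1 r2 : R) :
  1 < r1 -> r1 < r2 -> r2 <= 9 / 2 -> crit_drift r1 < crit_drift r2.
Proof.
  intros H1 H12 H2; apply (derive_pos_lt _ crit_drift_d _ _ H12).
  - intros x Hx; apply is_derive_crit_drift; nra.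
  - intros x Hx.
    assert (Z : 1 < x ^ 2) by nra.
    assert (Z' : x ^ 2 <= 81 / 4) by nra.
    unfold crit_drift_d; apply Rdiv_lt_0_compat; [| apply cosh_pos].
    replace (x ^ 8) with (x ^ 2 * (x ^ 2 * x ^ 2 * x ^ 2)) by ring.
    replace (x ^ 6) with (x ^ 2 * x ^ 2 * x ^ 2) by ring.
    replace (x ^ 4) with (x ^ 2 * x ^ 2) by ring.
    set (z := x ^ 2) in *; clearbody z.
    replace (_ / _) with
      ((10 * (z * z * z) + 13 * (z * z) + 10 * z - z * (z * z * z) / 2 - 1 / 2)
       / ((z - 1) ^ 3 * (1 + z))) by (field; lra).
    assert (0 < z * z * z) by nra.
    assert (z * (z * z * z) <= 81 / 4 * (z * z * z)) by nra.
    apply Rdiv_lt_0_compat; [nra |].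
    apply Rmult_lt_0_compat; [apply pow_lt |]; lra.
Qed.

(** * Certified numerical bounds *)

Lemma exp_upper (x : R) : 0 <= x < 64 -> exp x * (1 - x / 64) ^ 64 <= 1.
Proof.
  intros Hx.
  (* Using the tangent bound at x/64 costs about x^2/128 in the exponent, roughly 0.04 at x = 2.342,
     the largest argument needed. *)
  assert (E : exp x = exp (x / 64) ^ 64).
  { rewrite <- (Rpower_pow 64 _ (exp_pos _)); unfold Rpower.
    rewrite ln_exp; f_equal; simpl; field. }
  assert (H : exp (x / 64) * (1 - x / 64) <= 1).
  { replace 1 with (exp (x / 64) * exp (- (x / 64))) at 2
      by (rewrite <- exp_plus, Rplus_opp_r; apply exp_0).
    apply Rmult_le_compat_l; [left; apply exp_pos |].
    generalize (exp_ineq1_le (- (x / 64))); lra. }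
  rewrite E, <- Rpow_mult_distr.
  apply Rle_trans with (1 ^ 64); [| right; apply pow1].
  apply pow_incr; split; [| exact H].
  apply Rmult_le_pos; [left; apply exp_pos | lra].
Qed.

(* A certified lower bound: exp b <= (1 - b/64)^-64 <= y + sqrt (1 + y^2). *)
Lemma arcsinh_lower (b y c : R) :
  0 <= b < 64 -> 0 <= c -> c ^ 2 <= 1 + y ^ 2 ->
  1 <= (y + c) * (1 - b / 64) ^ 64 -> b <= arcsinh y.
Proof.
  intros Hb Hc Hcy H.
  assert (U := exp_upper b Hb).
  assert (P : 0 < (1 - b / 64) ^ 64) by (apply pow_lt; clear - Hb; lra).
  set (p := (1 - b / 64) ^ 64) in *; clearbody p.
  assert (C : c <= sqrt (y ^ 2 + 1)).
  { rewrite <- (sqrt_pow2 c Hc); apply sqrt_le_1_alt; lra. }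
  assert (L : exp b <= y + c) by (apply (Rmult_le_reg_r _ _ _ P); lra).
  unfold arcsinh; rewrite <- (ln_exp b).
  apply ln_le; [apply exp_pos | lra].
Qed.

Lemma cosh_upper (x c : R) : 0 <= c -> 1 + sinh x ^ 2 <= c ^ 2 -> cosh x <= c.
Proof.
  intros Hc H; rewrite <- cosh_sqr in H.
  generalize (cosh_pos x); nra.
Qed.

(** Since [crit_time] decreases for r > 1, this keeps the minima with s >= 0 inside the range r <
    9/2 where their speed is known to be below 1/2. The true value is about -0.05. *)
Lemma crit_time_9_2 : crit_time (9 / 2) < 0.
Proof.
  assert (HS : sinh (crit_pos (9 / 2)) = - (837 / 154)).
  { rewrite sinh_crit_pos; unfold crit_sinh; field. }
  assert (HC : cosh (crit_pos (9 / 2)) <= 5.527).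
  { apply cosh_upper; [| rewrite HS]; lra. }
  assert (HX : crit_pos (9 / 2) <= - 2.342).
  { unfold crit_pos; rewrite sinh_crit_pos in HS; rewrite HS, arcsinh_opp.
    assert (2.342 <= arcsinh (837 / 154)) by (apply (arcsinh_lower _ _ 5.525); lra).
    lra. }
  unfold crit_time, crit_ratio; lra.
Qed.

Lemma crit_time_5_2 : crit_time (5 / 2) <= crit_time (1 / 5).
Proof.
  assert (HS : sinh (crit_pos (5 / 2)) = - (185 / 42)).
  { rewrite sinh_crit_pos; unfold crit_sinh; field. }
  assert (HC : cosh (crit_pos (5 / 2)) <= 4.518).
  { apply cosh_upper; [| rewrite HS]; lra. }
  assert (HX : crit_pos (5 / 2) <= - 2.12).
  { unfold crit_pos; rewrite sinh_crit_pos in HS; rewrite HS, arcsinh_opp.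
    assert (2.12 <= arcsinh (185 / 42)) by (apply (arcsinh_lower _ _ 4.51); lra).
    lra. }
  assert (HS' : sinh (crit_pos (1 / 5)) = 19 / 30).
  { rewrite sinh_crit_pos; unfold crit_sinh; field. }
  assert (HC' : 1.18 <= cosh (crit_pos (1 / 5))).
  { generalize (cosh_sqr (crit_pos (1 / 5))) (cosh_pos (crit_pos (1 / 5))).
    rewrite HS'; nra. }
  assert (HX' : 0.56 <= crit_pos (1 / 5)).
  { unfold crit_pos; rewrite sinh_crit_pos in HS'; rewrite HS'.
    apply (arcsinh_lower _ _ 1.18); lra. }
  unfold crit_time, crit_ratio; lra.
Qed.

(** * Extrema of the profile *)

Lemma profile_decay (s eps : R) : 0 < eps ->
  exists B, 0 < B /\ forall x, B <= Rabs x -> Rabs (profile s x) < eps.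
Proof.
  intros Heps.
  assert (Hs := Rabs_pos s).
  (* With y = |x|, eps cosh x is at least eps/2 + eps y/2 + eps y^2/8. Once eps y >= 8 (|s| + 1),
     the last two terms absorb |s| + 1 and y. *)
  exists (8 * (Rabs s + 1) / eps).
  assert (HB : 0 < 8 * (Rabs s + 1) / eps) by (apply Rdiv_lt_0_compat; lra).
  split; [exact HB |]; intros x Hx.
  assert (HD := profile_denom_pos s x).
  assert (HC := cosh_pos x).
  assert (HC1 := cosh_lower x).
  assert (Hy : 0 < Rabs x) by lra.
  unfold profile, Rdiv; rewrite Rabs_mult, Rabs_inv, (Rabs_pos_eq (cosh x ^ 2 + _)) by lra.
  apply (Rmult_lt_reg_r _ _ _ HD); rewrite Rmult_assoc, Rinv_l, Rmult_1_r by lra.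
  assert (HN : Rabs ((s - x) * sinh x + cosh x) <= (Rabs s + Rabs x + 1) * cosh x).
  { eapply Rle_trans; [apply Rabs_triang |].
    rewrite Rabs_mult, (Rabs_pos_eq (cosh x)) by lra.
    assert (H1 : Rabs (s - x) <= Rabs s + Rabs x).
    { unfold Rminus; eapply Rle_trans; [apply Rabs_triang |]; rewrite Rabs_Ropp; lra. }
    assert (H2 : Rabs (sinh x) <= cosh x).
    { apply Rabs_le; generalize (cosh_sqr x); intros; split; nra. }
    generalize (Rabs_pos (s - x)) (Rabs_pos (sinh x)); nra. }
  apply Rle_lt_trans with (1 := HN).
  apply Rlt_le_trans with (eps * cosh x ^ 2);
    [| apply Rmult_le_compat_l; [lra | generalize (pow2_ge_0 (s - x)); lra]].
  replace (eps * cosh x ^ 2) with (eps * cosh x * cosh x) by ring.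
  apply Rmult_lt_compat_r; [exact HC |].
  apply Rlt_le_trans with (eps * ((1 + Rabs x / 2) ^ 2 / 2));
    [| apply Rmult_le_compat_l; lra].
  assert (Hx' : 8 * (Rabs s + 1) <= eps * Rabs x).
  { apply (Rmult_le_compat_l eps) in Hx; [| lra].
    replace (eps * (8 * (Rabs s + 1) / eps)) with (8 * (Rabs s + 1)) in Hx
      by (field; lra).
    exact Hx. }
  set (y := Rabs x) in *; set (z := Rabs s) in *; clearbody y z.
  replace (eps * ((1 + y / 2) ^ 2 / 2)) with (eps / 2 + eps * y / 2 + eps * y * y / 8)
    by field.
  nra.
Qed.

Lemma profile_continuous (s x : R) : continuity_pt (profile s) x.
Proof.
  apply continuity_pt_filterlim, (ex_derive_continuous (profile s)).
  eexists; apply is_derive_profile.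
Qed.

Lemma profile_max_exists (s : R) : exists p, forall x, profile s x <= profile s p.
Proof.
  (* At xi = s the profile is 1 / cosh s. A positive reference value and the decay make the maximum
     over a compact interval global. *)
  assert (H0 : 0 < profile s s).
  { unfold profile; rewrite Rminus_diag, Rmult_0_l, Rplus_0_l.
    generalize (cosh_pos s); intros; apply Rdiv_lt_0_compat; nra. }
  destruct (profile_decay s _ H0) as (B & HB & Hdecay).
  assert (HsB : Rabs s < B).
  { destruct (Rlt_le_dec (Rabs s) B) as [L | L]; [exact L |].
    generalize (Hdecay s L); rewrite Rabs_pos_eq; lra. }
  destruct (continuity_ab_maj (profile s) (- B) B) as (p & Hp & _).
  - lra.
  - intros; apply profile_continuous.
  - exists p; intros x.
    assert (Hsp : profile s s <= profile s p) by (apply Hp; apply Rabs_def2 in HsB; lra).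
    destruct (Rlt_le_dec (Rabs x) B) as [L | L].
    + apply Hp; apply Rabs_def2 in L; lra.
    + generalize (Hdecay x L) (Rle_abs (profile s x)); lra.
Qed.

Lemma profile_neg_somewhere (s : R) : exists x, x < 0 /\ profile s x < 0.
Proof.
  (* Chosen so that s + y >= 2 and cosh y < 2 sinh y, which make the numerator at -y negative. *)
  set (y := Rabs s + 2).
  assert (Hy : 2 <= y) by (unfold y; generalize (Rabs_pos s); lra).
  assert (Hsy : 2 <= s + y).
  { unfold y; generalize (Rle_abs (- s)); rewrite Rabs_Ropp; lra. }
  exists (- y); split; [lra |].
  assert (HS : cosh y < 2 * sinh y).
  { unfold cosh, sinh.
    assert (H1 : exp (- y) <= 1).
    { rewrite <- exp_0; left; apply exp_increasing; lra. }
    generalize (exp_ineq1_le y); intros.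
    assert (H2 : exp (- y) * exp y = 1)
      by (rewrite <- exp_plus, Rplus_opp_l; apply exp_0).
    generalize (exp_pos (- y)); nra. }
  assert (HC := cosh_pos y).
  assert (HD := profile_denom_pos s (- y)).
  unfold profile; apply Rdiv_neg_pos; [| exact HD].
  rewrite sinh_opp, cosh_opp; nra.
Qed.

(** The profile is positive at 0, so a negative minimum over x <= 0 is interior and hence a critical
    point. This produces the minimum of the branch r > 1, whether or not it is the global one. *)
Lemma profile_min_half_line (s : R) : exists m,
  m < 0 /\ profile s m < 0 /\ forall x, x <= 0 -> profile s m <= profile s x.
Proof.
  destruct (profile_neg_somewhere s) as (x0 & Hx0 & Hneg).
  destruct (profile_decay s (- profile s x0)) as (B & HB & Hdecay); [lra |].
  assert (HxB : Rabs x0 < B).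
  { destruct (Rlt_le_dec (Rabs x0) B) as [L | L]; [exact L |].
    generalize (Hdecay x0 L); rewrite Rabs_left; lra. }
  destruct (continuity_ab_min (profile s) (- B) 0) as (m & Hm & Hm').
  - lra.
  - intros; apply profile_continuous.
  - assert (Hmx : profile s m <= profile s x0) by (apply Hm; apply Rabs_def2 in HxB; lra).
    assert (P0 : 0 < profile s 0).
    { unfold profile; rewrite sinh_0, cosh_0, Rmult_0_r; apply Rdiv_lt_0_compat; [lra |].
      generalize (pow2_ge_0 (s - 0)); lra. }
    exists m; split; [| split].
    + destruct (Req_dec m 0) as [E | E]; [rewrite E in Hmx |]; lra.
    + lra.
    + intros x Hx; destruct (Rlt_le_dec (Rabs x) B) as [L | L].
      * apply Hm; apply Rabs_def2 in L; lra.
      * generalize (Hdecay x L); intros Hd; apply Rabs_def2 in Hd; lra.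
Qed.

Lemma profile_min_exists (s : R) : exists m, forall x, profile s m <= profile s x.
Proof.
  destruct (profile_min_half_line s) as (m1 & _ & _ & H1).
  destruct (profile_min_half_line (- s)) as (m2 & _ & _ & H2).
  assert (H2' : forall x, 0 <= x -> profile s (- m2) <= profile s x).
  { intros x Hx.
    rewrite <- (profile_opp s x), <- (profile_opp s (- m2)), Ropp_involutive.
    apply H2; lra. }
  destruct (Rle_lt_dec (profile s m1) (profile s (- m2))) as [L | L];
    [exists m1 | exists (- m2)];
    intros x; destruct (Rle_lt_dec x 0) as [X | X].
  - apply H1, X.
  - apply Rle_trans with (1 := L), H2'; lra.
  - apply Rle_trans with (profile s m1); [lra | apply H1, X].
  - apply H2'; lra.
Qed.

Lemma profile_local_max (s p a b : R) :
  a < p < b -> (forall x, a < x < b -> profile s x <= profile s p) ->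
  profile_dx s p = 0.
Proof.
  intros Hp H.
  assert (D : derivable_pt_lim (profile s) p (profile_dx s p))
    by apply is_derive_Reals, is_derive_profile.
  rewrite <- (derive_pt_eq_0 _ _ _ (exist _ _ D) D).
  apply (deriv_maximum _ a b); intuition.
Qed.

Lemma profile_local_min (s p a b : R) :
  a < p < b -> (forall x, a < x < b -> profile s p <= profile s x) ->
  profile_dx s p = 0.
Proof.
  intros Hp H.
  assert (D : derivable_pt_lim (profile s) p (profile_dx s p))
    by apply is_derive_Reals, is_derive_profile.
  rewrite <- (derive_pt_eq_0 _ _ _ (exist _ _ D) D).
  apply (deriv_minimum _ a b); intuition.
Qed.

Lemma profile_max_crit (s p : R) :
  (forall x, profile s x <= profile s p) ->
  exists r, -1 < r < 1 /\ p = crit_pos r /\ s = crit_time r.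
Proof.
  intros H.
  destruct (profile_critical s p) as (r & Hr & -> & ->).
  { apply (profile_local_max s p (p - 1) (p + 1)); [lra | intros; apply H]. }
  exists r; split; [| now split].
  (* A negative critical value cannot be maximal, since the profile is positive at xi = s. *)
  assert (N : ~ 1 < r ^ 2).
  { intros L; generalize (profile_crit_neg r L) (H (crit_time r)).
    unfold profile at 2; rewrite Rminus_diag, Rmult_0_l, Rplus_0_l.
    intros H1 H2; assert (HC := cosh_pos (crit_time r)).
    assert (0 < cosh (crit_time r) / (cosh (crit_time r) ^ 2 + 0 ^ 2))
      by (apply Rdiv_lt_0_compat; nra).
    lra. }
  split; nra.
Qed.

Lemma profile_min_crit_outer (s m a b : R) :
  a < m < b -> profile s m < 0 ->
  (forall x, a < x < b -> profile s m <= profile s x) ->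
  exists r, 1 < r ^ 2 /\ m = crit_pos r /\ s = crit_time r.
Proof.
  intros Hm Hneg H.
  destruct (profile_critical s m) as (r & Hr & -> & ->).
  { apply (profile_local_min s m a b Hm H). }
  exists r; split; [| now split].
  assert (N : ~ r ^ 2 < 1) by (intros L; generalize (profile_crit_pos r L); lra).
  lra.
Qed.

(** If the global minimum had r < -1 at s > 0, then -r > 1 would belong to time -s < s. As
    [crit_time] decreases, the half-line minimum has r1 < -r and is strictly deeper, a
    contradiction. At s = 0 the two minima tie, which leaves the mirror image as an alternative. *)
Lemma profile_min_crit (s m : R) :
  0 <= s -> (forall x, profile s m <= profile s x) ->
  exists r, 1 < r /\ s = crit_time r /\ (m = crit_pos r \/ s = 0 /\ m = - crit_pos r).
Proof.
  intros Hs H.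
  destruct (profile_min_half_line s) as (m1 & Hm1 & Hneg1 & H1).
  assert (Hmm1 := H m1).
  destruct (profile_min_crit_outer s m (m - 1) (m + 1)) as (r & Hr & Em & Es);
    [lra | lra | intros; apply H |].
  destruct (profile_min_crit_outer s m1 (m1 - 1) 0) as (r1 & Hr1 & Em1 & Es1);
    [lra | lra | intros; apply H1; lra |].
  assert (P1 : 1 < r1).
  { destruct (Rlt_le_dec 1 r1) as [L | L]; [exact L |].
    assert (L' : 1 < - r1) by nra.
    generalize (crit_pos_neg _ L'); rewrite crit_pos_opp; lra. }
  destruct (Rlt_le_dec 1 r) as [L | L]; [exists r; tauto |].
  assert (L' : 1 < - r) by nra.
  exists (- r); split; [exact L' |].
  destruct Hs as [Hs | Hs].
  - exfalso.
    assert (O : r1 < - r).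
    { destruct (Rlt_le_dec r1 (- r)) as [O | [O | O]]; [exact O | |].
      - generalize (crit_time_decr _ _ L' O); rewrite crit_time_opp; lra.
      - rewrite <- O, crit_time_opp in Es1; lra. }
    generalize (profile_crit_sqr_decr _ _ P1 O).
    rewrite crit_time_opp, crit_pos_opp, profile_opp, <- Es, <- Es1, <- Em, <- Em1.
    nra.
  - rewrite crit_time_opp, crit_pos_opp; split; [lra | right; lra].
Qed.

(** * Growth of the distance between the extrema *)

Lemma crit_pos_variation_inner (r1 r2 : R) :
  0 <= r2 -> r2 < r1 -> r1 < 1 -> crit_time r1 <= crit_time (1 / 5) ->
  crit_time r1 - crit_time r2 < 2 * (crit_pos r1 - crit_pos r2).
Proof.
  intros H2 H12 H1 HT.
  assert (L : r1 <= 1 / 5).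
  { destruct (Rle_lt_dec r1 (1 / 5)) as [L | L]; [exact L |].
    generalize (crit_time_incr (1 / 5) r1); lra. }
  generalize (crit_drift_incr_small r2 r1 H2 H12 L); unfold crit_drift; lra.
Qed.

(* The distance grows because d xi / d s is above 1/2 for the maximum and below 1/2
   for the minimum until crit_time (1/5); from crit_time (5/2) <= crit_time (1/5) on, the
   minimum moves backwards. *)
Lemma crit_distance_incr (r1 r2 q1 q2 : R) :
  0 <= r1 < 1 -> 0 <= r2 < 1 -> 1 < q1 -> 1 < q2 ->
  crit_time r1 = crit_time q1 -> crit_time r2 = crit_time q2 ->
  0 <= crit_time r2 -> crit_time r2 < crit_time r1 ->
  crit_pos r2 - crit_pos q2 < crit_pos r1 - crit_pos q1.
Proof.
  intros Hr1 Hr2 Hq1 Hq2 E1 E2 T0 T21.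
  assert (Hr : r2 < r1).
  { destruct (Rlt_le_dec r2 r1) as [L | [L | L]]; [exact L | |].
    - generalize (crit_time_incr r1 r2); lra.
    - rewrite L in T21; lra. }
  assert (Hq : q1 < q2).
  { destruct (Rlt_le_dec q1 q2) as [L | [L | L]]; [exact L | |].
    - generalize (crit_time_decr q2 q1 Hq2 L); lra.
    - rewrite L in E2; lra. }
  assert (Hq2' : q2 < 9 / 2).
  { destruct (Rlt_le_dec q2 (9 / 2)) as [L | [L | L]]; [exact L | |].
    - generalize (crit_time_decr (9 / 2) q2) crit_time_9_2; lra.
    - generalize crit_time_9_2; rewrite L; lra. }
  assert (H5 := crit_time_5_2).
  assert (HX : crit_pos r2 < crit_pos r1) by (apply crit_pos_incr; lra).
  destruct (Rle_lt_dec q2 (5 / 2)) as [Q2 | Q2].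
  { generalize (crit_pos_incr_near_1 q1 q2 Hq1 Hq Q2); lra. }
  assert (Hmin : forall q, 5 / 2 <= q -> q < q2 ->
            2 * (crit_pos q - crit_pos q2) < crit_time q - crit_time q2).
  { intros q Hq5 Hqq; generalize (crit_drift_incr_large q q2); unfold crit_drift; lra. }
  destruct (Rle_lt_dec q1 (5 / 2)) as [Q1 | Q1].
  (* The interval of times contains [crit_time (5 / 2)]: up to it the minimum gains less than half
     of the elapsed time, afterwards it only loses ground. *)
  - assert (HX1 : crit_pos q1 <= crit_pos (5 / 2)).
    { destruct Q1 as [Q1 | Q1]; [| rewrite Q1; lra].
      generalize (crit_pos_incr_near_1 q1 (5 / 2)); lra. }
    assert (HT1 : crit_time (5 / 2) <= crit_time q1).
    { destruct Q1 as [Q1 | Q1]; [| rewrite Q1; lra].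
      generalize (crit_time_decr q1 (5 / 2)); lra. }
    generalize (Hmin (5 / 2)); intros M.
    destruct (Rle_lt_dec r1 (1 / 5)) as [R1 | R1].
    + assert (crit_time r1 <= crit_time (1 / 5)).
      { destruct R1 as [R1 | R1]; [| rewrite R1; lra].
        generalize (crit_time_incr r1 (1 / 5)); lra. }
      generalize (crit_pos_variation_inner r1 r2); lra.
    + assert (HX5 := crit_pos_incr (1 / 5) r1).
      destruct (Rlt_le_dec r2 (1 / 5)) as [R2 | R2].
      * generalize (crit_pos_variation_inner (1 / 5) r2); lra.
      * assert (crit_time (1 / 5) <= crit_time r2).
        { destruct R2 as [R2 | R2]; [| rewrite R2; lra].
          generalize (crit_time_incr (1 / 5) r2); lra. }
        lra.
  - assert (HT1 : crit_time q1 < crit_time (5 / 2)) by (apply crit_time_decr; lra).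
    generalize (crit_pos_variation_inner r1 r2) (Hmin q1); lra.
Qed.

(** At s = 0 the maximum is at 0 and the possible minima are symmetric about it, so both choices of
    m give the same distance. *)
Lemma profile_positions (s p m : R) :
  0 <= s -> (forall x, profile s x <= profile s p) ->
  (forall x, profile s m <= profile s x) ->
  exists r q, 0 <= r < 1 /\ 1 < q /\ crit_time r = s /\ crit_time q = s /\
    p = crit_pos r /\ (m = crit_pos q \/ s = 0 /\ m = - crit_pos q) /\
    Rabs (p - m) = crit_pos r - crit_pos q /\
    (0 < s -> m < p).
Proof.
  intros Hs Hp Hm.
  destruct (profile_max_crit s p Hp) as (r & Hr & Ep & Er).
  destruct (profile_min_crit s m Hs Hm) as (q & Hq & Eq & Em).
  assert (Hr0 : 0 <= r).
  { destruct (Rle_lt_dec 0 r) as [L | L]; [exact L |].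
    generalize (crit_time_incr r 0); rewrite crit_time_0; lra. }
  assert (HX : 0 <= crit_pos r).
  { rewrite <- crit_pos_0; destruct Hr0 as [L | <-]; [| lra].
    left; apply crit_pos_incr; lra. }
  assert (HQ := crit_pos_neg q Hq).
  exists r, q; repeat match goal with |- _ /\ _ => split end; try lra; try assumption.
  - destruct Em as [-> | [E0 ->]]; rewrite Ep; [apply Rabs_pos_eq; lra |].
    assert (R0 : r = 0).
    { destruct Hr0 as [L | <-]; [| reflexivity].
      generalize (crit_time_incr 0 r); rewrite crit_time_0; lra. }
    rewrite R0, crit_pos_0 in *.
    rewrite Rabs_left1; lra.
Qed.

Lemma profile_distance_incr (s1 s2 p1 m1 p2 m2 : R) :
  0 <= s2 -> s2 < s1 ->
  (forall x, profile s1 x <= profile s1 p1) ->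
  (forall x, profile s1 m1 <= profile s1 x) ->
  (forall x, profile s2 x <= profile s2 p2) ->
  (forall x, profile s2 m2 <= profile s2 x) ->
  Rabs (p2 - m2) < Rabs (p1 - m1).
Proof.
  intros Hs2 Hs12 Hp1 Hm1 Hp2 Hm2.
  destruct (profile_positions s1 p1 m1) as
    (r1 & q1 & Hr1 & Hq1 & Er1 & Eq1 & _ & _ & -> & _); [lra | assumption .. |].
  destruct (profile_positions s2 p2 m2) as
    (r2 & q2 & Hr2 & Hq2 & Er2 & Eq2 & _ & _ & -> & _); [lra | assumption .. |].
  apply crit_distance_incr; try assumption; lra.
Qed.

(** * Large times *)

Lemma cosh_plus (x y : R) : cosh (x + y) = cosh x * cosh y + sinh x * sinh y.
Proof. unfold cosh, sinh; rewrite Ropp_plus_distr, !exp_plus; field. Qed.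

Lemma cosh_minus (x y : R) : cosh (x - y) = cosh x * cosh y - sinh x * sinh y.
Proof. unfold Rminus; rewrite cosh_plus, cosh_opp, sinh_opp; ring. Qed.

(** This brings the pair close to the form of twice the profile: sinh L takes the place of s - x,
    and only the summand cosh x of the numerator is missing. *)
Lemma soliton_pair (x L : R) :
  1 / cosh (x - L) - 1 / cosh (x + L)
  = 2 * sinh x * sinh L / (cosh x ^ 2 + sinh L ^ 2).
Proof.
  assert (H1 := cosh_pos (x - L)); assert (H2 := cosh_pos (x + L)).
  assert (HD : 0 < cosh x ^ 2 + sinh L ^ 2).
  { generalize (cosh_pos x) (pow2_ge_0 (sinh L)); nra. }
  assert (E : cosh (x - L) * cosh (x + L) = cosh x ^ 2 + sinh L ^ 2).
  { rewrite cosh_plus, cosh_minus.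
    transitivity (cosh x ^ 2 * cosh L ^ 2 - sinh x ^ 2 * sinh L ^ 2); [ring |].
    rewrite (cosh_sqr L), (cosh_sqr x); ring. }
  rewrite <- E.
  transitivity ((cosh (x + L) - cosh (x - L)) / (cosh (x - L) * cosh (x + L)));
    [field; lra |].
  rewrite cosh_plus at 1; rewrite cosh_minus at 1; f_equal; ring.
Qed.

Lemma sinh_ln (y : R) : 0 < y -> sinh (ln y) = (y - / y) / 2.
Proof. intros Hy; unfold sinh; rewrite exp_Ropp, exp_ln; auto. Qed.

(** L = ln (2 s) gives sinh L = s - 1/(4 s), which differs from s - x by 1/(4 s) - x. Here d1 is the
    contribution of the extra cosh x and d2 that of the shift by 1/(4 s) - x, harmless because cosh
    x dominates x^2. Both bounds are uniform in x. *)
Lemma profile_soliton_pair (s x : R) : 1 <= s ->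
  exists d1 d2,
    2 * profile s x - (1 / cosh (x - ln (2 * s)) - 1 / cosh (x + ln (2 * s)))
      = 2 * d1 + 2 * d2 /\
    0 <= d1 <= 3 / (2 * s) /\ d2 ^ 2 <= 16 / (3 * s).
Proof.
  intros Hs.
  set (sg := sinh (ln (2 * s))).
  assert (Hsg : sg = s - / (4 * s)).
  { unfold sg; rewrite sinh_ln by lra; field; lra. }
  assert (Hi : 0 < / (4 * s) <= / 4).
  { split; [apply Rinv_0_lt_compat; lra | apply Rinv_le_contravar; lra]. }
  assert (HC := cosh_pos x); assert (HS := cosh_sqr x).
  assert (HD := profile_denom_pos s x).
  assert (HCL := cosh_lower x); assert (HCx := Rabs_le_cosh x).
  assert (HX := Rabs_pos x); assert (HX1 := Rle_abs x).
  assert (HX2 : - Rabs x <= x) by (generalize (Rle_abs (- x)); rewrite Rabs_Ropp; lra).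
  set (C := cosh x) in *; set (S := sinh x) in *; set (h := s - x) in *.
  assert (HE : 0 < C ^ 2 + sg ^ 2) by (generalize (pow2_ge_0 sg); nra).
  exists (C / (C ^ 2 + h ^ 2)),
    (S * (h - sg) * (C ^ 2 - h * sg) / ((C ^ 2 + h ^ 2) * (C ^ 2 + sg ^ 2))).
  split; [| split].
  - rewrite soliton_pair; unfold profile; fold C S h sg; field; lra.
  - split; [left; apply Rdiv_lt_0_compat; lra |].
    apply Rle_div_l; [lra |].
    replace (3 / (2 * s) * (C ^ 2 + h ^ 2)) with (3 * (C ^ 2 + h ^ 2) / (2 * s))
      by (field; lra).
    apply (Rle_div_r C); [lra |].
    assert (Hsh : s <= h + C) by (unfold h; lra).
    apply (Rmult_le_compat_l C) in Hsh; [| lra].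
    generalize (pow2_ge_0 (C - h)) (pow2_ge_0 h); lra.
  - unfold Rdiv at 1; rewrite Rpow_mult_distr, pow_inv.
    apply Rle_trans with ((h - sg) ^ 2 / (C ^ 2 + sg ^ 2)).
    + apply Rle_div_l; [now apply pow_lt, Rmult_lt_0_compat |].
      replace ((h - sg) ^ 2 / (C ^ 2 + sg ^ 2) * ((C ^ 2 + h ^ 2) * (C ^ 2 + sg ^ 2)) ^ 2)
        with ((h - sg) ^ 2 * ((C ^ 2 + h ^ 2) * ((C ^ 2 + h ^ 2) * (C ^ 2 + sg ^ 2))))
        by (field; lra).
      replace ((S * (h - sg) * (C ^ 2 - h * sg)) ^ 2)
        with ((h - sg) ^ 2 * (S ^ 2 * (C ^ 2 - h * sg) ^ 2)) by ring.
      apply Rmult_le_compat_l; [apply pow2_ge_0 |].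
      apply Rmult_le_compat; try apply pow2_ge_0.
      * generalize (pow2_ge_0 h); lra.
      (* Lagrange's identity: (C^2 - h sg)^2 + C^2 (h + sg)^2 = (C^2 + h^2) (C^2 + sg^2). *)
      * generalize (pow2_ge_0 (C * (h + sg))); lra.
    + apply Rle_div_l; [exact HE |].
      replace (16 / (3 * s) * (C ^ 2 + sg ^ 2)) with (16 * (C ^ 2 + sg ^ 2) / (3 * s))
        by (field; lra).
      apply (Rle_div_r _ _ (3 * s)); [lra |].
      assert (Hh : (h - sg) ^ 2 <= 8 * C).
      { replace (h - sg) with (/ (4 * s) - x) by (unfold h; lra).
        apply Rle_trans with ((1 + Rabs x) ^ 2); [| lra].
        rewrite <- (pow2_abs (_ - _)); apply pow_incr; split; [apply Rabs_pos |].
        apply Rabs_le; lra. }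
      generalize (pow2_ge_0 (C - sg)); intros.
      assert (3 * s <= 4 * sg) by lra.
      apply Rle_trans with (8 * C * (4 * sg)); [| nra].
      apply Rmult_le_compat; try lra; apply pow2_ge_0.
Qed.

Lemma profile_asymptotics (eps : R) : 0 < eps ->
  exists M, 1 <= M /\ forall s x, M < s ->
    Rabs (2 * profile s x - (1 / cosh (x - ln (2 * s)) - 1 / cosh (x + ln (2 * s)))) < eps.
Proof.
  intros He.
  assert (H1 : 0 < 6 / eps) by (apply Rdiv_lt_0_compat; lra).
  assert (H2 : 0 < 100 / eps ^ 2) by (apply Rdiv_lt_0_compat; [lra | now apply pow_lt]).
  (* s > 6/eps makes d1 < eps/4, and s > 100/eps^2 makes d2^2 < (eps/4)^2, for which 256/3 in place
     of 100 would do. *)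
  exists (1 + 6 / eps + 100 / eps ^ 2); split; [lra |]; intros s x Hs.
  destruct (profile_soliton_pair s x) as (d1 & d2 & -> & Hd1 & Hd2); [lra |].
  assert (K1 : 3 / (2 * s) < eps / 4).
  { apply Rlt_div_l; [lra |].
    assert (6 < s * eps) by (apply (Rlt_div_l 6 s eps); lra).
    lra. }
  assert (K2 : 16 / (3 * s) < (eps / 4) ^ 2).
  { apply Rlt_div_l; [lra |].
    assert (100 < s * eps ^ 2)
      by (apply (Rlt_div_l 100 s (eps ^ 2)); [now apply pow_lt | lra]).
    lra. }
  assert (K3 : Rabs d2 < eps / 4).
  { rewrite <- (Rabs_pos_eq (eps / 4)) by lra; apply Rsqr_lt_abs_0; unfold Rsqr; lra. }
  apply Rabs_def2 in K3; apply Rabs_def1; lra.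
Qed.

(** * Logarithmic law for the positions *)

Lemma crit_ratio_near_1 (r : R) : 0 <= r -> Rabs (r - 1) < 1 ->
  1 - Rabs (r - 1) <= crit_ratio r <= 1.
Proof.
  intros Hr H.
  assert (E : crit_ratio r = 1 - (r - 1) ^ 2 / (1 + r ^ 2))
    by (unfold crit_ratio; field; nra).
  assert (0 <= (r - 1) ^ 2 / (1 + r ^ 2) <= Rabs (r - 1)); [| lra].
  assert (P := Rabs_pos (r - 1)).
  assert (Q := pow2_ge_0 r).
  split.
  - apply Rdiv_le_0_compat; [apply pow2_ge_0 | lra].
  - apply Rle_div_l; [nra |].
    rewrite <- (pow2_abs (r - 1)).
    generalize (Rmult_le_pos _ _ P (pow2_ge_0 r)); nra.
Qed.

Lemma crit_pos_near_1 (Y : R) : 0 < Y -> exists delta, 0 < delta <= 1 / 2 /\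
  forall r, r <> 1 -> Rabs (r - 1) < delta -> Y <= Rabs (crit_pos r).
Proof.
  intros HY.
  assert (HS := sinh_pos Y HY).
  (* For r in (1/2, 3/2) the product |sinh (crit_pos r)| |r - 1| = r (3 + r^2) / (1 + r) exceeds
     1/2, whereas |crit_pos r| < Y would make it smaller than 1/2. *)
  exists (/ 2 / (sinh Y + 1)); split.
  - split; [apply Rdiv_lt_0_compat; lra |].
    apply Rle_div_l; lra.
  - intros r Hr1 Hr.
    assert (P : 0 < Rabs (r - 1)) by (apply Rabs_pos_lt; lra).
    assert (Hr' : Rabs (r - 1) * (sinh Y + 1) < / 2) by (apply Rlt_div_r; lra).
    assert (B : 1 / 2 < r < 3 / 2).
    { assert (L : Rabs (r - 1) < / 2) by nra; apply Rabs_def2 in L; lra. }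
    destruct (Rle_lt_dec Y (Rabs (crit_pos r))) as [L | L]; [exact L | exfalso].
    assert (HSr : sinh (crit_pos r) * (1 - r ^ 2) = r * (3 + r ^ 2)).
    { rewrite sinh_crit_pos; unfold crit_sinh; field; intros E.
      assert ((1 - r) * (1 + r) = 0) by lra; nra. }
    apply Rabs_def2 in L; destruct L as [L1 L2].
    apply sinh_lt in L1; apply sinh_lt in L2; rewrite sinh_opp in L2.
    assert (K : Rabs (sinh (crit_pos r)) < sinh Y) by (apply Rabs_def1; lra).
    assert (Q : Rabs (sinh (crit_pos r)) * (Rabs (r - 1) * (1 + r)) = r * (3 + r ^ 2)).
    { rewrite <- (Rabs_pos_eq (1 + r)), <- !Rabs_mult, <- (Rabs_pos_eq (r * _)) by nra.
      rewrite <- HSr, <- (Rabs_Ropp (_ * (1 - _))); f_equal; ring. }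
    assert (Q1 : Rabs (sinh (crit_pos r)) * Rabs (r - 1) <= / 2).
    { generalize (Rabs_pos (sinh (crit_pos r))); nra. }
    nra.
Qed.

(* Writing y = |crit_pos r|, one has
   2 crit_time r e^-y = w (1 + e^-2y) +- 2 y e^-y, which tends to 1 as r -> 1. *)
Lemma crit_pos_log (eps : R) : 0 < eps -> exists delta, 0 < delta <= 1 / 2 /\
  forall r, r <> 1 -> Rabs (r - 1) < delta -> 0 < crit_time r ->
    Rabs (Rabs (crit_pos r) - ln (2 * crit_time r)) < eps.
Proof.
  intros He.
  (* |v - 1| < k implies |ln v| < eps. *)
  set (k := Rmin (exp eps - 1) (1 - exp (- eps))).
  assert (Hk : 0 < k).
  { apply Rmin_glb_lt.
    - generalize (exp_ineq1 eps); lra.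
    - assert (exp (- eps) < 1) by (rewrite <- exp_0; apply exp_increasing; lra); lra. }
  assert (Hk1 : 1 + k <= exp eps)
    by (generalize (Rmin_l (exp eps - 1) (1 - exp (- eps))); fold k; lra).
  assert (Hk2 : exp (- eps) <= 1 - k)
    by (generalize (Rmin_r (exp eps - 1) (1 - exp (- eps))); fold k; lra).
  (* With E = exp (- y) one has E y^2 <= 4, so y >= 20/k gives y E <= k/5 and E^2 <= k/20. Together
     with the k/4 from [crit_ratio] the total deviation stays below k. *)
  assert (HY : 0 < 20 / k) by (apply Rdiv_lt_0_compat; lra).
  destruct (crit_pos_near_1 (20 / k) HY) as (d & Hd & Hcrit).
  exists (Rmin d (k / 4)); split.
  { split; [apply Rmin_glb_lt; lra |].
    apply Rle_trans with (1 := Rmin_l _ _); lra. }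
  intros r Hr1 Hr HT.
  assert (Hr2 := Rlt_le_trans _ _ _ Hr (Rmin_l _ _)).
  assert (Hr3 := Rlt_le_trans _ _ _ Hr (Rmin_r _ _)).
  specialize (Hcrit r Hr1 Hr2).
  set (y := Rabs (crit_pos r)) in *.
  assert (Hy : 0 < y) by lra.
  assert (Hky : 20 <= k * y).
  { apply Rle_div_l in Hcrit; lra. }
  assert (Hw : 1 - k / 4 <= crit_ratio r <= 1).
  { destruct (crit_ratio_near_1 r); [| lra | lra].
    apply Rabs_def2 in Hr2; lra. }
  set (w := crit_ratio r) in *.
  set (E := exp (- y)).
  assert (HE : 0 < E) by apply exp_pos.
  assert (HEy : E * exp y = 1)
    by (unfold E; rewrite <- exp_plus, Rplus_opp_l; apply exp_0).
  assert (Hexp : (1 + y / 2) ^ 2 <= exp y).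
  { replace (exp y) with (exp (y / 2) ^ 2)
      by (simpl; rewrite Rmult_1_r, <- exp_plus; f_equal; lra).
    apply pow_incr; split; [lra | apply exp_ineq1_le]. }
  assert (HEb : E * y * y <= 4) by nra.
  assert (HyE : y * E <= k / 5).
  { apply (Rmult_le_reg_r y); [exact Hy |]; nra. }
  assert (HE1 : E <= 1).
  { unfold E; rewrite <- exp_0; left; apply exp_increasing; lra. }
  assert (HE2 : E * E <= k / 20).
  { apply (Rmult_le_reg_r y); [exact Hy |]; nra. }
  assert (Hv : 2 * crit_time r * E = w * (1 + E * E) + 2 * crit_pos r * E).
  { unfold crit_time; fold w; rewrite <- cosh_Rabs; fold y.
    unfold cosh; fold E.
    transitivity (w * (E * exp y + E * E) + 2 * crit_pos r * E); [field |].
    rewrite HEy; reflexivity. }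
  assert (HX : - y <= crit_pos r <= y).
  { apply Rabs_le_between; unfold y; lra. }
  assert (HXE : - (k / 5) <= crit_pos r * E <= k / 5) by (split; nra).
  assert (Hv1 : 1 - k < 2 * crit_time r * E < 1 + k).
  { assert (k1 : k < 1) by (generalize (exp_pos (- eps)); lra).
    assert (0 <= w * (E * E) <= k / 20) by (split; nra).
    rewrite Hv; split; lra. }
  replace (ln (2 * crit_time r)) with (y + ln (2 * crit_time r * E)).
  - assert (L1 : ln (2 * crit_time r * E) < eps).
    { rewrite <- (ln_exp eps); apply ln_increasing; [apply Rmult_lt_0_compat |]; lra. }
    assert (L2 : - eps < ln (2 * crit_time r * E)).
    { rewrite <- (ln_exp (- eps)); apply ln_increasing; [apply exp_pos | lra]. }
    apply Rabs_def1; lra.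
  - rewrite ln_mult by lra; unfold E; rewrite ln_exp; ring.
Qed.

(** Each extremum contributes ln (2 s) up to a vanishing error; monotonicity of [crit_time] on each
    branch turns large s into r and q close to 1. *)
Lemma crit_distance_log (eps : R) : 0 < eps -> exists M, forall r q,
  0 <= r < 1 -> 1 < q -> crit_time r = crit_time q -> M < crit_time r ->
  Rabs (crit_pos r - crit_pos q - 2 * ln (2 * crit_time r)) < eps.
Proof.
  intros He.
  destruct (crit_pos_log (eps / 2)) as (d & Hd & H); [lra |].
  exists (Rmax 0 (Rmax (crit_time (1 - d / 2)) (crit_time (1 + d / 2)))).
  intros r q Hr Hq E HM.
  assert (M0 := Rle_lt_trans _ _ _ (Rmax_l _ _) HM).
  assert (HM' := Rle_lt_trans _ _ _ (Rmax_r _ _) HM).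
  assert (M1 := Rle_lt_trans _ _ _ (Rmax_l _ _) HM').
  assert (M2 := Rle_lt_trans _ _ _ (Rmax_r _ _) HM').
  assert (R1 : 1 - d / 2 < r).
  { destruct (Rlt_le_dec (1 - d / 2) r) as [L | [L | L]]; [exact L | |].
    - generalize (crit_time_incr r (1 - d / 2)); lra.
    - rewrite L in M1; lra. }
  assert (Q1 : q < 1 + d / 2).
  { destruct (Rlt_le_dec q (1 + d / 2)) as [L | [L | L]]; [exact L | |].
    - generalize (crit_time_decr (1 + d / 2) q); lra.
    - rewrite <- L in E; lra. }
  assert (Hr' := H r); assert (Hq' := H q).
  assert (Xq := crit_pos_neg q Hq).
  assert (Xr : 0 < crit_pos r) by (rewrite <- crit_pos_0; apply crit_pos_incr; lra).
  rewrite (Rabs_pos_eq (crit_pos r)) in Hr' by lra.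
  rewrite (Rabs_left (crit_pos q)), <- E in Hq' by lra.
  assert (Ar : Rabs (crit_pos r - ln (2 * crit_time r)) < eps / 2)
    by (apply Hr'; [lra | apply Rabs_def1; lra | lra]).
  assert (Aq : Rabs (- crit_pos q - ln (2 * crit_time r)) < eps / 2)
    by (apply Hq'; [lra | apply Rabs_def1; lra | lra]).
  apply Rabs_def2 in Ar; apply Rabs_def2 in Aq; apply Rabs_def1; lra.
Qed.

(** * Back to the doublet *)

Lemma profile_extrema_opp (s p m : R) :
  (forall x, profile s x <= profile s p) -> (forall x, profile s m <= profile s x) ->
  (forall x, profile (- s) x <= profile (- s) (- p)) /\
  (forall x, profile (- s) (- m) <= profile (- s) x).
Proof.
  intros Hp Hm; split; intros x; rewrite profile_opp, <- (Ropp_involutive x), profile_opp;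
    auto.
Qed.

(** Transfers results for s >= 0 to all times: the reflection exchanges the order of the extrema but
    keeps their distance. *)
Lemma profile_extrema_Rabs (s p m : R) :
  (forall x, profile s x <= profile s p) -> (forall x, profile s m <= profile s x) ->
  exists p' m', (forall x, profile (Rabs s) x <= profile (Rabs s) p') /\
    (forall x, profile (Rabs s) m' <= profile (Rabs s) x) /\
    Rabs (p' - m') = Rabs (p - m).
Proof.
  intros Hp Hm; unfold Rabs at 1 2 3 4; destruct (Rcase_abs s).
  - destruct (profile_extrema_opp s p m Hp Hm) as [Hp' Hm'].
    exists (- p), (- m); split; [exact Hp' | split; [exact Hm' |]].
    rewrite <- Rabs_Ropp; f_equal; ring.
  - exists p, m; auto.
Qed.

Lemma doublet_extrema_iff (a : R) (e : vec3) (t p m : R) :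
  0 < a -> enorm e = 1 ->
  (soliton_at (doublet a (a ^ 2) e) e t p <->
   forall x, profile (2 * a ^ 3 * t) x
             <= profile (2 * a ^ 3 * t) (a * (p - a ^ 2 * t))) /\
  (antisoliton_at (doublet a (a ^ 2) e) e t m <->
   forall x, profile (2 * a ^ 3 * t) (a * (m - a ^ 2 * t))
             <= profile (2 * a ^ 3 * t) x).
Proof.
  intros Ha He.
  assert (D : forall x, dot (doublet a (a ^ 2) e x t) e
                = 2 * a * profile (2 * a ^ 3 * t) (a * (x - a ^ 2 * t))).
  { intros x; rewrite doublet_profile, dot_scal_l, (dot_unit _ He) by exact Ha; ring. }
  assert (X : forall x, a * (x / a + a ^ 2 * t - a ^ 2 * t) = x) by (intros; field; lra).
  unfold soliton_at, antisoliton_at.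
  repeat split; intros H x.
  - specialize (H (x / a + a ^ 2 * t)); rewrite !D, X in H.
    apply Rmult_le_reg_l in H; lra.
  - rewrite !D; apply Rmult_le_compat_l; [lra | apply H].
  - specialize (H (x / a + a ^ 2 * t)); rewrite !D, X in H.
    apply Rmult_le_reg_l in H; lra.
  - rewrite !D; apply Rmult_le_compat_l; [lra | apply H].
Qed.

Lemma minus_scal_vec3 (k l : R) (v : vec3) :
  minus (scal k v : vec3) (scal l v) = scal (k - l) v.
Proof.
  symmetry; exact (@scal_minus_distr_r R_Ring
    (prod_ModuleSpace _ (prod_ModuleSpace _ (Ring_ModuleSpace _) (Ring_ModuleSpace _))
       (Ring_ModuleSpace _)) k l v).
Qed.

Lemma soliton_sum (a : R) (e : vec3) (L L' : R) (x t : R) :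
  plus (soliton a L e x t) (soliton a L' (opp e) x t)
  = scal (a / cosh (a * (x - a ^ 2 * t) - L) - a / cosh (a * (x - a ^ 2 * t) - L')) e.
Proof.
  unfold soliton; rewrite <- minus_scal_vec3; unfold minus; f_equal.
  exact (@scal_opp_r R_Ring
    (prod_ModuleSpace _ (prod_ModuleSpace _ (Ring_ModuleSpace _) (Ring_ModuleSpace _))
       (Ring_ModuleSpace _)) _ e).
Qed.

Lemma soliton_amplitude (a delta : R) (e : vec3) (x t : R) :
  0 < a -> enorm e = 1 ->
  enorm (soliton a delta e x t) <= a /\
  (enorm (soliton a delta e x t) = a <-> x = a ^ 2 * t + delta / a).
Proof.
  intros Ha He; unfold soliton; rewrite (enorm_scal_unit _ _ He).
  set (y := a * (x - a ^ 2 * t) - delta).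
  assert (HC := cosh_ge_1 y).
  rewrite Rabs_pos_eq by (apply Rdiv_le_0_compat; lra).
  split; [apply Rle_div_l; nra | split].
  - intros E.
    assert (E1 : cosh y = 1).
    { apply (Rmult_eq_reg_l a); [| lra].
      rewrite <- E at 1; field; lra. }
    apply cosh_eq_1 in E1; unfold y in E1.
    apply (Rmult_eq_reg_l a); [| lra].
    transitivity (a * (a ^ 2 * t) + delta); [lra | field; lra].
  - intros E.
    assert (Y : y = 0) by (unfold y; rewrite E; field; lra).
    rewrite Y, cosh_0; field.
Qed.

(** [sign t] covers both limits. For t < 0 the profile is evaluated at -xi, where evenness of cosh
    interchanges the two solitons and so flips the sign. The logarithm is ln (2 s) with s = 2 a^3
    |t|. *)
Lemma doublet_asymptotics (a : R) (e : vec3) (eps : R) :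
  0 < a -> enorm e = 1 -> 0 < eps -> exists M, 0 <= M /\ forall t x, M < Rabs t ->
  let k L := a / cosh (a * (x - a ^ 2 * t) - L) - a / cosh (a * (x - a ^ 2 * t) + L) in
  enorm (minus (doublet a (a ^ 2) e x t)
               (scal (sign t * k (ln (4 * a ^ 3 * Rabs t))) e)) < eps.
Proof.
  intros Ha He Heps.
  assert (Ha3 : 0 < 2 * a ^ 3) by (generalize (pow_lt a 3 Ha); lra).
  destruct (profile_asymptotics (eps / a)) as (M & HM & H); [now apply Rdiv_lt_0_compat |].
  exists (M / (2 * a ^ 3)); split; [apply Rdiv_le_0_compat; lra |].
  intros t x Ht k.
  rewrite doublet_profile, minus_scal_vec3, (enorm_scal_unit _ _ He) by exact Ha.
  apply Rlt_div_l in Ht; [| exact Ha3].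
  set (xi := a * (x - a ^ 2 * t)) in *.
  assert (K : forall L, k L = a * (1 / cosh (xi - L) - 1 / cosh (xi + L))).
  { intros L; unfold k; fold xi; field.
    generalize (cosh_pos (xi - L)) (cosh_pos (xi + L)); lra. }
  rewrite K.
  replace (4 * a ^ 3 * Rabs t) with (2 * (2 * a ^ 3 * Rabs t)) by ring.
  set (L := ln (2 * (2 * a ^ 3 * Rabs t))).
  assert (G : forall d, Rabs d < eps / a -> Rabs (a * d) < eps).
  { intros d Hd; rewrite Rabs_mult, (Rabs_pos_eq a) by lra.
    apply Rlt_div_r in Hd; lra. }
  assert (Ht' : M < 2 * a ^ 3 * Rabs t) by lra.
  destruct (Rtotal_order t 0) as [N | [Z | P]].
  - rewrite sign_eq_m1 by exact N.
    specialize (H _ (- xi) Ht'); fold L in H.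
    replace (- xi - L) with (- (xi + L)) in H by ring.
    replace (- xi + L) with (- (xi - L)) in H by ring.
    rewrite !cosh_opp in H.
    replace (2 * a ^ 3 * Rabs t) with (- (2 * a ^ 3 * t)) in H
      by (rewrite Rabs_left by exact N; ring).
    rewrite profile_opp in H.
    apply G in H; eapply Rle_lt_trans; [right | exact H]; f_equal; ring.
  - exfalso; rewrite Z, Rabs_R0 in Ht'; lra.
  - rewrite sign_eq_1 by exact P.
    specialize (H _ xi Ht'); fold L in H.
    replace (profile (2 * a ^ 3 * Rabs t) xi) with (profile (2 * a ^ 3 * t) xi) in H
      by (rewrite Rabs_pos_eq by lra; reflexivity).
    apply G in H; eapply Rle_lt_trans; [right | exact H]; f_equal; ring.
Qed.

(** The form in |t| serves both the approach before t = 0 and the minimality of the distance at t =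
    0. *)
Lemma doublet_distance_incr (a : R) (e : vec3) (t1 t2 p1 m1 p2 m2 : R) :
  0 < a -> enorm e = 1 -> Rabs t2 < Rabs t1 ->
  let u := doublet a (a ^ 2) e in
  soliton_at u e t1 p1 -> antisoliton_at u e t1 m1 ->
  soliton_at u e t2 p2 -> antisoliton_at u e t2 m2 ->
  Rabs (p2 - m2) < Rabs (p1 - m1).
Proof.
  intros Ha He Ht u Hp1 Hm1 Hp2 Hm2; subst u.
  assert (Ha3 : 0 < 2 * a ^ 3) by (generalize (pow_lt a 3 Ha); lra).
  rewrite (proj1 (doublet_extrema_iff a e t1 p1 m1 Ha He)) in Hp1.
  rewrite (proj2 (doublet_extrema_iff a e t1 p1 m1 Ha He)) in Hm1.
  rewrite (proj1 (doublet_extrema_iff a e t2 p2 m2 Ha He)) in Hp2.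
  rewrite (proj2 (doublet_extrema_iff a e t2 p2 m2 Ha He)) in Hm2.
  destruct (profile_extrema_Rabs _ _ _ Hp1 Hm1) as (P1 & M1 & HP1 & HM1 & D1).
  destruct (profile_extrema_Rabs _ _ _ Hp2 Hm2) as (P2 & M2 & HP2 & HM2 & D2).
  assert (L : Rabs (P2 - M2) < Rabs (P1 - M1)).
  { apply (profile_distance_incr (Rabs (2 * a ^ 3 * t1)) (Rabs (2 * a ^ 3 * t2)));
      try assumption; [apply Rabs_pos |].
    rewrite !Rabs_mult; apply Rmult_lt_compat_l; [| exact Ht].
    rewrite <- Rabs_mult, Rabs_pos_eq; lra. }
  rewrite D1, D2 in L.
  replace (a * (p2 - a ^ 2 * t2) - a * (m2 - a ^ 2 * t2)) with (a * (p2 - m2)) in L by ring.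
  replace (a * (p1 - a ^ 2 * t1) - a * (m1 - a ^ 2 * t1)) with (a * (p1 - m1)) in L by ring.
  rewrite !(Rabs_mult a), (Rabs_pos_eq a) in L by lra.
  apply Rmult_lt_reg_l in L; assumption.
Qed.

Lemma doublet_distance_log (a : R) (e : vec3) (eps : R) :
  0 < a -> enorm e = 1 -> 0 < eps ->
  let u := doublet a (a ^ 2) e in
  exists t0, forall t, t0 < Rabs t -> forall p m,
    soliton_at u e t p -> antisoliton_at u e t m ->
    Rabs (Rabs (p - m) - 2 / a * ln (4 * a ^ 3 * Rabs t)) < eps.
Proof.
  intros Ha He Heps u; subst u.
  assert (Ha3 : 0 < 2 * a ^ 3) by (generalize (pow_lt a 3 Ha); lra).
  destruct (crit_distance_log (a * eps)) as (M & H); [now apply Rmult_lt_0_compat |].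
  exists (M / (2 * a ^ 3)); intros t Ht p m Hp Hm.
  apply Rlt_div_l in Ht; [| exact Ha3].
  rewrite (proj1 (doublet_extrema_iff a e t p m Ha He)) in Hp.
  rewrite (proj2 (doublet_extrema_iff a e t p m Ha He)) in Hm.
  destruct (profile_extrema_Rabs _ _ _ Hp Hm) as (P & Q & HP & HQ & D).
  destruct (profile_positions _ _ _ (Rabs_pos _) HP HQ)
    as (r & q & Hr & Hq & Er & Eq & _ & _ & D' & _).
  rewrite D' in D.
  specialize (H r q Hr Hq).
  rewrite Er, Eq, D in H.
  rewrite (Rabs_mult (2 * a ^ 3)), (Rabs_pos_eq (2 * a ^ 3)) in H by lra.
  specialize (H eq_refl ltac:(lra)).
  replace (a * (p - a ^ 2 * t) - a * (m - a ^ 2 * t)) with (a * (p - m)) in H by ring.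
  rewrite (Rabs_mult a), (Rabs_pos_eq a) in H by lra.
  replace (4 * a ^ 3 * Rabs t) with (2 * (2 * a ^ 3 * Rabs t)) by ring.
  set (l := ln _) in *.
  apply (Rmult_lt_reg_l a); [exact Ha |].
  rewrite <- (Rabs_pos_eq a) at 1 by lra.
  rewrite <- Rabs_mult.
  replace (a * (Rabs (p - m) - 2 / a * l)) with (a * Rabs (p - m) - 2 * l) by (field; lra).
  exact H.
Qed.

Lemma doublet_order (a : R) (e : vec3) (t p m : R) :
  0 < a -> enorm e = 1 ->
  let u := doublet a (a ^ 2) e in
  soliton_at u e t p -> antisoliton_at u e t m ->
  (t < 0 -> p < m) /\ (0 < t -> m < p).
Proof.
  intros Ha He u Hp Hm; subst u.
  assert (Ha3 : 0 < 2 * a ^ 3) by (generalize (pow_lt a 3 Ha); lra).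
  rewrite (proj1 (doublet_extrema_iff a e t p m Ha He)) in Hp.
  rewrite (proj2 (doublet_extrema_iff a e t p m Ha He)) in Hm.
  split; intros Ht; apply (Rmult_lt_reg_l a); try exact Ha.
  - destruct (profile_extrema_opp _ _ _ Hp Hm) as [Hp' Hm'].
    assert (S : 0 < - (2 * a ^ 3 * t)) by nra.
    destruct (profile_positions _ _ _ (Rlt_le _ _ S) Hp' Hm')
      as (r & q & _ & _ & _ & _ & _ & _ & _ & L).
    specialize (L S); lra.
  - assert (S : 0 < 2 * a ^ 3 * t) by now apply Rmult_lt_0_compat.
    destruct (profile_positions _ _ _ (Rlt_le _ _ S) Hp Hm)
      as (r & q & _ & _ & _ & _ & _ & _ & _ & L).
    specialize (L S); lra.
Qed.

Lemma doublet_extrema_exist (a : R) (e : vec3) (t : R) :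
  0 < a -> enorm e = 1 ->
  let u := doublet a (a ^ 2) e in
  (exists p, soliton_at u e t p) /\ (exists m, antisoliton_at u e t m).
Proof.
  intros Ha He u.
  assert (X : forall x, a * (x / a + a ^ 2 * t - a ^ 2 * t) = x) by (intros; field; lra).
  destruct (profile_max_exists (2 * a ^ 3 * t)) as [P HP].
  destruct (profile_min_exists (2 * a ^ 3 * t)) as [M HM].
  split; [exists (P / a + a ^ 2 * t) | exists (M / a + a ^ 2 * t)].
  - unfold u; rewrite (proj1 (doublet_extrema_iff a e t _ 0 Ha He)), X; exact HP.
  - unfold u; rewrite (proj2 (doublet_extrema_iff a e t 0 _ Ha He)), X; exact HM.
Qed.

Theorem mainTheorem2 :
  forall (a c : R) (e2 : vec3),
    0 < a -> c = a ^ 2 -> enorm e2 = 1 ->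
    let u := doublet a c e2 in
    (* u solves the vector mKdV equation *)
    is_vmKdV_solution u /\
    (* large-time formulas *)
    asymptotic_to (Rbar_locally p_infty) u
      (fun x t =>
         scal (a / cosh (a * (x - c * t) - ln (4 * a ^ 3 * t))
               - a / cosh (a * (x - c * t) + ln (4 * a ^ 3 * t))) e2) /\
    asymptotic_to (Rbar_locally m_infty) u
      (fun x t =>
         scal (- (a / cosh (a * (x - c * t) - ln (4 * a ^ 3 * Rabs t)))
               + a / cosh (a * (x - c * t) + ln (4 * a ^ 3 * Rabs t))) e2) /\
    (* their right-hand sides are sums of a soliton and an anti-soliton ... *)
    (forall L x t,
       scal (a / cosh (a * (x - c * t) - L) - a / cosh (a * (x - c * t) + L)) e2
         = plus (soliton a L e2 x t) (soliton a (- L) (opp e2) x t) /\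
       scal (- (a / cosh (a * (x - c * t) - L)) + a / cosh (a * (x - c * t) + L)) e2
         = plus (soliton a (- L) e2 x t) (soliton a L (opp e2) x t)) /\
    (* ... which are solutions of amplitude a, reached at the centre only *)
    (forall delta e, enorm e = 1 ->
       is_vmKdV_solution (soliton a delta e) /\
       forall x t,
         enorm (soliton a delta e x t) <= a /\
         (enorm (soliton a delta e x t) = a <-> x = c * t + delta / a)) /\
    (* the soliton and the anti-soliton have a position at every time *)
    (forall t, (exists p, soliton_at u e2 t p) /\
               (exists m, antisoliton_at u e2 t m)) /\
    (* their distance grows logarithmically *)
    (forall eps, 0 < eps ->
       exists t0, forall t, t0 < Rabs t ->
         forall p m, soliton_at u e2 t p -> antisoliton_at u e2 t m ->
           Rabs (Rabs (p - m) - 2 / a * ln (4 * a ^ 3 * Rabs t)) < eps) /\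
    (* the soliton is behind before t = 0 and ahead afterwards *)
    (forall t p m, soliton_at u e2 t p -> antisoliton_at u e2 t m ->
       (t < 0 -> p < m) /\ (0 < t -> m < p)) /\
    (* the soliton catches up with the anti-soliton *)
    (forall t1 t2 p1 m1 p2 m2, t1 < t2 -> t2 <= 0 ->
       soliton_at u e2 t1 p1 -> antisoliton_at u e2 t1 m1 ->
       soliton_at u e2 t2 p2 -> antisoliton_at u e2 t2 m2 ->
       Rabs (p2 - m2) < Rabs (p1 - m1)) /\
    (* the closest approach is at t = 0 *)
    (forall t p m p0 m0, t <> 0 ->
       soliton_at u e2 t p -> antisoliton_at u e2 t m ->
       soliton_at u e2 0 p0 -> antisoliton_at u e2 0 m0 ->
       Rabs (p0 - m0) < Rabs (p - m)) /\
    (* the impulse at that time *)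
    (forall x,
       u x 0 = scal (2 * a *
                     ((cosh (a * x) - a * x * sinh (a * x))
                      / ((cosh (a * x)) ^ 2 + (a * x) ^ 2))) e2).
Proof.
  intros a c e2 Ha -> He u.
  refine (conj _ (conj _ (conj _ (conj _ (conj _ (conj _ (conj _ (conj _ (conj _
            (conj _ _)))))))))).
  - apply doublet_solution; assumption.
  - intros eps Heps.
    destruct (doublet_asymptotics a e2 eps Ha He Heps) as (M & HM & H).
    exists M; intros t Ht x; specialize (H t x).
    rewrite Rabs_pos_eq in H by lra.
    rewrite sign_eq_1 in H by lra.
    cbv beta zeta in H; rewrite Rmult_1_l in H; apply H, Ht.
  - intros eps Heps.
    destruct (doublet_asymptotics a e2 eps Ha He Heps) as (M & HM & H).
    exists (- M); intros t Ht x; specialize (H t x).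
    rewrite sign_eq_m1 in H by lra.
    cbv beta zeta in H.
    assert (E : forall A B, -1 * (A - B) = - A + B) by (intros; ring).
    rewrite E in H.
    apply H; rewrite Rabs_left; lra.
  - intros L x t; rewrite !soliton_sum; unfold Rminus; rewrite Ropp_involutive.
    split; [reflexivity | f_equal; ring].
  - intros delta e Hu; split; [now apply soliton_solution |].
    intros x t; now apply soliton_amplitude.
  - intros t; now apply doublet_extrema_exist.
  - intros eps Heps; now apply doublet_distance_log.
  - intros t p m; now apply doublet_order.
  - intros t1 t2 p1 m1 p2 m2 H12 H2; apply doublet_distance_incr; try assumption.
    rewrite (Rabs_left t1), (Rabs_left1 t2); lra.
  - intros t p m p0 m0 Ht Hp Hm Hp0 Hm0.
    apply (doublet_distance_incr a e2 t 0 p m p0 m0); try assumption.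
    rewrite Rabs_R0; now apply Rabs_pos_lt.
  - intros x; unfold u, doublet; do 2 f_equal.
    rewrite !Rmult_0_r, !Rminus_0_r, Rminus_0_l; f_equal; ring.
Qed.
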